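(* The maximal cardinality of a real fibre of a real polynomial Keller map $\mathbb{R}^3\to\mathbb{R}^3$ with non-dense image is not determined by its generic degree. Precisely, for every even $d\geq 6$: the map $G_d\colon\mathbb{R}^3\to\mathbb{R}^3$ has generic degree $d$ and all its real fibres $G_d^{-1}(w)$, $w\in\mathbb{R}^3$, have cardinality at most four; whereas there is a finitely supported real sequence $\eta=(\eta_j)_{j\geq 1}$ such that $G_\eta\colon\mathbb{R}^3\to\mathbb{R}^3$ is a Keller map with non-dense image, of the same generic degree $d$, having a real fibre of cardinality $d$. Consequently, there is no uniform bound on the cardinalities of real fibres for real polynomial Keller maps $\mathbb{R}^3\to\mathbb{R}^3$ with non-dense image.
   Context: A real polynomial map $H\colon\mathbb{R}^n\to\mathbb{R}^n$ is Keller if its Jacobian determinant is a nonzero constant; its generic degree is $\mu(H)=[\mathbb{C}(x_1,\dots,x_n):\mathbb{C}(H_1,\dots,H_n)]$. Density is in the Euclidean topology. A real fibre is the set of real preimages of a point of the real target. Put $A=1+xy$, $B=A^2z+y^2(4+3xy)$, $P=AB$, $Q=y+3xB$, $R=2x-3x^2y-x^3z$. For a finitely supported sequence $\eta=(\eta_j)_{j\geq 1}$ of real numbers, $G_\eta=(P,Q_\eta,R_\eta)$ with $$Q_\eta=Q+\sum_{j\geq 1}\eta_jA^2x^jB^{j+2},\qquad R_\eta=R-\sum_{j\geq 1}\eta_j\frac{j}{j+2}x^{j+2}B^{j+2}.$$ For even $d\geq 4$, $G_d$ is the case $\eta_{d-2}=1$ and all other $\eta_j=0$, i.e. $G_d=(P,\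 Q+A^2x^{d-2}B^d,\ R-\frac{d-2}{d}x^dB^d)$. *)

(* Defs.v *)
From HB Require Import structures.
From mathcomp Require Import all_boot all_order all_algebra.
From mathcomp Require Import fraction complex mpoly.
From mathcomp Require Import boolp classical_sets functions cardinality fsbigop.
From mathcomp Require Import reals topology normedtype.

Set Implicit Arguments.
Unset Strict Implicit.
Unset Printing Implicit Defensive.

Import Order.TTheory GRing.Theory Num.Theory.
Import numFieldNormedType.Exports.

Local Open Scope classical_set_scope.
Local Open Scope card_scope.
Local Open Scope ring_scope.

(* A polynomial map R^n -> R^n is given by the tuple of its n components;
   points of R^n are row vectors, whose topology is the product one. *)
Definition polymap (R : realType) (n : nat) := n.-tuple {mpoly R[n]}.

Definition polymap_eval (R : realType) (n : nat) (H : polymap R n)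
    (v : 'rV[R]_n) : 'rV[R]_n :=
  \row_(i < n) (tnth H i).@[fun j => v 0 j].

Definition jacobian (R : realType) (n : nat) (H : polymap R n) :
    'M[{mpoly R[n]}]_n :=
  \matrix_(i < n, j < n) mderiv j (tnth H i).

Definition keller (R : realType) (n : nat) (H : polymap R n) : Prop :=
  exists2 c : R, c != 0 & \det (jacobian H) = c%:MP.

Definition nondense_image (R : realType) (n : nat) (H : polymap R n) : Prop :=
  ~ dense (range (polymap_eval H)).

Definition real_fibre (R : realType) (n : nat) (H : polymap R n)
    (w : 'rV[R]_n) : set 'rV[R]_n :=
  [set v | polymap_eval H v = w].

Definition max_fibre_card (R : realType) (n : nat) (H : polymap R n)
    (m : nat) : Prop :=
  (exists w, real_fibre H w #= `I_m) /\ (forall w, real_fibre H w #<= `I_m).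

(* Degree of L over a subfield with carrier K, as the cardinality of a K-basis
   b of L; {subfield L} does not apply, as L need not be finite over a field
   given beforehand as a type. *)
Definition extension_degree (L : fieldType) (K : set L) (d : nat) : Prop :=
  exists b : 'I_d -> L,
    (forall c : 'I_d -> L, (forall i, K (c i)) ->
       \sum_(i < d) c i * b i = 0 -> forall i, c i = 0) /\
    (forall f : L, exists2 c : 'I_d -> L,
       forall i, K (c i) & f = \sum_(i < d) c i * b i).

Definition complexify (R : realType) (n : nat) (H : polymap R n) :
    n.-tuple {mpoly (complex R)[n]} :=
  map_tuple (map_mpoly (real_complex R)) H.

(* The subfield C(H_1, ..., H_n) of C(x_1, ..., x_n): all p(H) / q(H) with
   p, q complex polynomials in n variables and q(H) nonzero. *)
Definition ratfield (R : realType) (n : nat) (H : polymap R n) :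
    set {fraction {mpoly (complex R)[n]}} :=
  [set f | exists p q : {mpoly (complex R)[n]},
     q \mPo complexify H != 0 /\
     f = tofrac (p \mPo complexify H) / tofrac (q \mPo complexify H)].

Definition generic_degree (R : realType) (n : nat) (H : polymap R n)
    (d : nat) : Prop :=
  extension_degree (ratfield H) d.

Definition vx (R : realType) : {mpoly R[3]} := 'X_(inord 0).
Definition vy (R : realType) : {mpoly R[3]} := 'X_(inord 1).
Definition vz (R : realType) : {mpoly R[3]} := 'X_(inord 2).

Definition polA (R : realType) : {mpoly R[3]} := 1 + vx R * vy R.
Definition polB (R : realType) : {mpoly R[3]} :=
  polA R ^+ 2 * vz R + vy R ^+ 2 * (4%:R + 3%:R * vx R * vy R).
Definition polP (R : realType) : {mpoly R[3]} := polA R * polB R.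
Definition polQ (R : realType) : {mpoly R[3]} :=
  vy R + 3%:R * vx R * polB R.
Definition polR (R : realType) : {mpoly R[3]} :=
  2%:R * vx R - 3%:R * vx R ^+ 2 * vy R - vx R ^+ 3 * vz R.

(* A sequence (eta_j)_{j >= 1} is a function on nat whose value at 0 is
   never used. *)
Definition finitely_supported (R : realType) (eta : nat -> R) : Prop :=
  finite_set [set j : nat | (0 < j)%N /\ eta j != 0].

(* These sums have their usual meaning for finitely supported eta only:
   \sum_(j \in D) F j is 0 when F has infinite support in D. *)
Definition polQ_eta (R : realType) (eta : nat -> R) : {mpoly R[3]} :=
  polQ R + \sum_(j \in [set j : nat | (0 < j)%N])
             eta j *: (polA R ^+ 2 * vx R ^+ j * polB R ^+ (j + 2)).
Definition polR_eta (R : realType) (eta : nat -> R) : {mpoly R[3]} :=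
  polR R - \sum_(j \in [set j : nat | (0 < j)%N])
             (eta j * (j%:R / (j + 2)%:R)) *:
               (vx R ^+ (j + 2) * polB R ^+ (j + 2)).

Definition G_eta (R : realType) (eta : nat -> R) : polymap R 3 :=
  [tuple polP R; polQ_eta eta; polR_eta eta].

Definition G_d (R : realType) (d : nat) : polymap R 3 :=
  G_eta (fun j => (j == (d - 2)%N)%:R : R).

(* Main.v *)
Require Import Defs.
From HB Require Import structures.
From mathcomp Require Import all_boot all_order all_algebra.
From mathcomp Require Import separable fieldext polyrcf finmap.
From mathcomp Require Import fraction complex mpoly.
From mathcomp Require Import boolp classical_sets functions cardinality fsbigop.
From mathcomp Require Import reals topology normedtype.
From mathcomp Require Import ring lra.

Set Implicit Arguments.
Unset Strict Implicit.
Unset Printing Implicit Defensive.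

Import Order.TTheory GRing.Theory Num.Theory.
Import numFieldNormedType.Exports.

Local Open Scope classical_set_scope.
Local Open Scope card_scope.
Local Open Scope ring_scope.

(** Let g = sum_j eta_j X^j. Where A <> 0, put s = x / A. Then s is a root of
      W(s) = 2 P s^3 - Q s^2 + 2 s + sum_j eta_j (2 / (j + 2)) (s P)^(j + 2) - R
    where (P, Q, R) now denotes the value of G_eta; moreover W'(s) = 2 / A, and
    (x, y, z) is a rational function of (P, Q, s). Hence, over P <> 0, the fibre
    is in bijection with the simple real roots of W, and over P = 0 it has at
    most three points. Since C(x, y, z) = C(P, Q, R)(s) and W is, up to sign,
    monic of degree one in R, the powers of s below d = deg W form a basis, so
    the generic degree is d. If d is even and the top coefficient is positive,
    then W is positive on the real line as soon as R is very negative, uniformly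
    for (P, Q) near (1, 0), so the image is not dense. For G_d the third
    derivative of W is a s^(d - 3) + b with d - 3 odd, which has at most one real
    root, so W has at most four by Rolle. On the other hand, over P = 1 every
    polynomial of degree d with linear coefficient 2 arises as W for some eta,
    in particular a multiple of (s + 1)(s + 2)...(s + d). *)

(** * The map and the candidate inverse, over any commutative ring *)

Section Coordinates.
Variable F : comNzRingType.
Implicit Types (g h : {poly F}) (x y z p q s : F).

Definition ptA x y := 1 + x * y.
Definition ptB x y z := ptA x y ^+ 2 * z + y ^+ 2 * (4%:R + 3%:R * x * y).
Definition ptP x y z := ptA x y * ptB x y z.
Definition ptQ g x y z :=
  y + 3%:R * x * ptB x y z + ptP x y z ^+ 2 * g.[x * ptB x y z].
Definition ptR h x y z :=
  2%:R * x - 3%:R * x ^+ 2 * y - x ^+ 3 * z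
  - (x * ptB x y z) ^+ 2 * h.[x * ptB x y z].

(* The polynomial W of the header (without - R), half its derivative, and the
   coordinate y, as functions of P = p, Q = q and s; g and h stand for
   sum_j eta_j X^j and sum_j eta_j (j / (j + 2)) X^j. *)
Definition invW g h p q s :=
  2%:R * p * s ^+ 3 - q * s ^+ 2 + 2%:R * s
  + (s * p) ^+ 2 * (g.[s * p] - h.[s * p]).
Definition inva g p q s :=
  1 - s * q + 3%:R * p * s ^+ 2 + s * p ^+ 2 * g.[s * p].
Definition invy g p q s := q - 3%:R * s * p - p ^+ 2 * g.[s * p].

End Coordinates.

(** * Transport of the coordinates along ring morphisms (evaluations, complexification,
    fractions) *)

Section CoordinatesMorphism.
Variables (F1 F2 : comNzRingType) (f : {rmorphism F1 -> F2}).

Lemma rmorph_ptA x y : f (ptA x y) = ptA (f x) (f y).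
Proof. by rewrite /ptA rmorphD rmorphM rmorph1. Qed.

Lemma rmorph_ptB x y z : f (ptB x y z) = ptB (f x) (f y) (f z).
Proof.
by rewrite /ptB !(rmorphD, rmorphM, rmorphXn, rmorph_nat, rmorph_ptA).
Qed.

Lemma rmorph_ptP x y z : f (ptP x y z) = ptP (f x) (f y) (f z).
Proof. by rewrite /ptP rmorphM rmorph_ptA rmorph_ptB. Qed.

Lemma rmorph_ptQ g x y z :
  f (ptQ g x y z) = ptQ (map_poly f g) (f x) (f y) (f z).
Proof.
rewrite /ptQ -rmorph_ptB -rmorph_ptP -rmorphM horner_map.
move: (ptB _ _ _) (ptP _ _ _) => b c.
by rewrite !(rmorphD, rmorphM, rmorphXn, rmorph_nat).
Qed.

Lemma rmorph_ptR h x y z :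
  f (ptR h x y z) = ptR (map_poly f h) (f x) (f y) (f z).
Proof.
rewrite /ptR -rmorph_ptB -rmorphM horner_map.
move: (ptB _ _ _) => b.
by rewrite !(rmorphXn, rmorph_nat, rmorphB, rmorphM).
Qed.

End CoordinatesMorphism.

(** * Mutually inverse formulas between (x, y, z) with A nonzero and (P, Q, s) *)

Section Inversion.
Variable F : fieldType.
Implicit Types (g h : {poly F}) (x y z p q s : F).

Lemma ratio_mulP x y z :
  ptA x y != 0 -> x / ptA x y * ptP x y z = x * ptB x y z.
Proof. by move=> A0; rewrite /ptP; field. Qed.

(** Since P = A B, both g and h are evaluated at s P = x B on either side. Their values can thus be
    taken as arbitrary scalars, and what remains is a rational identity in x, y, z with denominator
    a power of A. *)
Lemma invW_ratio g h x y z : ptA x y != 0 ->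
  invW g h (ptP x y z) (ptQ g x y z) (x / ptA x y) = ptR h x y z.
Proof.
move=> A0; rewrite /invW ratio_mulP // /ptQ /ptR.
set gu := g.[_]; set hu := h.[_].
rewrite /ptP /ptB; move: A0; rewrite /ptA => A0.
by field; rewrite ?A0 ?a0 ?oner_neq0.
Qed.

Lemma inva_ratio g x y z : ptA x y != 0 ->
  inva g (ptP x y z) (ptQ g x y z) (x / ptA x y) = (ptA x y)^-1.
Proof.
move=> A0; rewrite /inva ratio_mulP // /ptQ; set gu := g.[_].
rewrite /ptP /ptB; move: A0; rewrite /ptA => A0.
by field; rewrite ?A0 ?a0 ?oner_neq0.
Qed.

Lemma invy_ratio g x y z : ptA x y != 0 ->
  invy g (ptP x y z) (ptQ g x y z) (x / ptA x y) = y.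
Proof.
move=> A0; rewrite /invy ratio_mulP // /ptQ; set gu := g.[_].
rewrite /ptP /ptB; move: A0; rewrite /ptA => A0.
by field; rewrite ?A0 ?a0 ?oner_neq0.
Qed.

(** As [inva] stands for 1 / A, these solve s = x / A for x, and P / A = B = A^2 z + y^2 (4 + 3 x y)
    for z. *)
Definition invx g p q s := s / inva g p q s.
Definition invz g p q s :=
  (p * inva g p q s - invy g p q s ^+ 2 *
     (4%:R + 3%:R * invx g p q s * invy g p q s)) * inva g p q s ^+ 2.

Lemma invz_ratio g x y z : ptA x y != 0 ->
  invz g (ptP x y z) (ptQ g x y z) (x / ptA x y) = z.
Proof.
move=> A0; rewrite /invz /invx inva_ratio // invy_ratio //.
rewrite /ptP /ptB; move: A0; rewrite /ptA => A0.
by field; rewrite ?A0 ?a0 ?oner_neq0.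
Qed.

Lemma invx_ratio g x y z : ptA x y != 0 ->
  invx g (ptP x y z) (ptQ g x y z) (x / ptA x y) = x.
Proof. by move=> A0; rewrite /invx inva_ratio // invrK divfK. Qed.

Section Point.
Variables (g h : {poly F}) (p q s : F).
Hypothesis a0 : inva g p q s != 0.
Let x := invx g p q s.
Let y := invy g p q s.
Let z := invz g p q s.

(** The definitions give [inva] + s [invy] = 1, whence 1 + x y = 1 / [inva]. *)
Lemma ptA_inv : ptA x y = (inva g p q s)^-1.
Proof.
move: a0; rewrite /ptA /x /y /invx /inva /invy; set gu := g.[_] => a0'.
by field; rewrite ?A0 ?a0 ?oner_neq0.
Qed.

Lemma ptB_inv : ptB x y z = p * inva g p q s.
Proof.
by rewrite /ptB ptA_inv /z /invz -/x -/y; field.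
Qed.

Lemma ptP_inv : ptP x y z = p.
Proof. by rewrite /ptP ptA_inv ptB_inv mulrC mulfK. Qed.

Lemma mulB_inv : x * ptB x y z = s * p.
Proof. by rewrite ptB_inv /x /invx; field. Qed.

Lemma ptQ_inv : ptQ g x y z = q.
Proof.
rewrite /ptQ -mulrA mulB_inv ptP_inv /y /invy; set gu := g.[_]; ring.
Qed.

Lemma ratio_inv : x / ptA x y = s.
Proof. by rewrite ptA_inv invrK /x /invx divfK. Qed.

Lemma ptR_inv : ptR h x y z = invW g h p q s.
Proof.
have A0 : ptA x y != 0 by rewrite ptA_inv invr_eq0.
by rewrite -(invW_ratio g h z A0) ptP_inv ptQ_inv ratio_inv.
Qed.

End Point.
End Inversion.

(** * The companion polynomial h of g *)

Section Primitive.
Variable F : fieldType.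
Hypothesis charF0 : forall n, n.+1%:R != 0 :> F.

(* The factor j / (j + 2) makes X^2 * polyh g a primitive of X^2 * g^`(). *)
Definition polyh (g : {poly F}) : {poly F} :=
  \poly_(j < size g) (g`_j * (j%:R / (j + 2)%:R)).

Lemma coef_polyh g j : (polyh g)`_j = g`_j * (j%:R / (j + 2)%:R).
Proof.
by rewrite coef_poly; case: ltnP => // /(nth_default 0) ->; rewrite mul0r.
Qed.

(** This is (X^2 h)' = X^2 g' divided by X; coefficientwise it says (j + 2) h_j = j g_j. *)
Lemma polyh_deriv g :
  (polyh g) *+ 2 + 'X * (polyh g)^`() = 'X * g^`().
Proof.
apply/polyP => -[|j]; rewrite coefD coefMn !coefXM /= coef_polyh.
  by rewrite mul0r mulr0 mul0rn addr0.
rewrite !coef_deriv coef_polyh -mulrnDr -[_ *+ (2 + _)]mulr_natr -mulrA.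
by rewrite (addnC 2) addn2 divfK ?charF0 // mulr_natr.
Qed.

End Primitive.

(** * The Jacobian determinant is the constant -2 *)

Section Jacobian.
Variables (F : fieldType).
Hypothesis charF0 : forall n, n.+1%:R != 0 :> F.
Local Notation MP := {mpoly F[3]}.
Implicit Types (g h : {poly F}).

Lemma det_mx33 (K : comNzRingType) (M : 'M[K]_3) :
  let m i j := M (inord i) (inord j) in
  \det M = m 0 0 * (m 1 1 * m 2 2 - m 1 2 * m 2 1)
         - m 0 1 * (m 1 0 * m 2 2 - m 1 2 * m 2 0)
         + m 0 2 * (m 1 0 * m 2 1 - m 1 1 * m 2 0).
Proof.
move=> m; have mE i j : M i j = m i j by rewrite /m !inord_val.
rewrite (expand_det_row _ ord0) !big_ord_recl big_ord0 /cofactor.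
rewrite !(expand_det_row _ ord0) !big_ord_recl !big_ord0 /cofactor !det_mx11.
rewrite !mxE !mE /= /bump /=; ring.
Qed.

Lemma mderiv_horner (n : nat) (i : 'I_n) g (u : {mpoly F[n]}) :
  mderiv i (map_poly (@mpolyC n F) g).[u]
  = (map_poly (@mpolyC n F) g^`()).[u] * mderiv i u.
Proof.
elim/poly_ind: g => [|g c IH]; first by
  rewrite deriv0 !map_poly0 !horner0 mderiv0 mul0r.
rewrite derivD derivM derivC derivX addr0 mulr1 !rmorphD !rmorphM /=.
rewrite map_polyX map_polyC !hornerE mderivD mderivM IH mderivC.
ring.
Qed.

Definition gX : MP := 'X_(inord 0).
Definition gY : MP := 'X_(inord 1).
Definition gZ : MP := 'X_(inord 2).

Definition Gtuple g : 3.-tuple MP :=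
  [tuple ptP gX gY gZ; ptQ (map_poly (@mpolyC 3 F) g) gX gY gZ;
         ptR (map_poly (@mpolyC 3 F) (polyh g)) gX gY gZ].

Lemma mderiv_var (i j : 'I_3) : mderiv i 'X_j = (i == j)%:R :> MP.
Proof.
rewrite mderivX mnm1E eq_sym; case: eqP => [->|_]; last by rewrite scale0r.
rewrite (_ : _ - _ = 0)%MM ?mpolyX0 ?scale1r //.
by apply/mnmP=> k; rewrite mnmBE subnn mnm0E.
Qed.


Section Derivation.
Variable j : 'I_3.
Local Notation D := (mderiv j).
Local Notation MC := (map_poly (@mpolyC 3 F)).
Let A := ptA gX gY.
Let B := ptB gX gY gZ.
Let P := ptP gX gY gZ.
Let U := gX * B.

Let mderiv_nat n : D (n%:R : MP) = 0.
Proof. by rewrite mderivMn mderivC mul0rn. Qed.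

Let mderivE := (mderiv_nat, mderivB, mderivD, mderivM).

Lemma mderiv_ptA : D A = D gX * gY + gX * D gY.
Proof. by rewrite mderivD mderivC add0r mderivM. Qed.

Lemma mderiv_ptB : D B = 2%:R * A * D A * gZ + A ^+ 2 * D gZ
  + 2%:R * gY * D gY * (4%:R + 3%:R * gX * gY)
  + gY ^+ 2 * (3%:R * D gX * gY + 3%:R * gX * D gY).
Proof.
rewrite /B /ptB -/A !expr2; move: A => A'.
by rewrite !mderivE; ring.
Qed.

Lemma mderiv_ptP : D P = D A * B + A * D B.
Proof. exact: mderivM. Qed.

Lemma mderiv_ptU : D U = D gX * B + gX * D B.
Proof. exact: mderivM. Qed.

Lemma mderiv_ptQ g : D (ptQ (MC g) gX gY gZ) =
  D gY + 3%:R * D U + 2%:R * P * D P * (MC g).[U]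
  + P ^+ 2 * (MC g^`()).[U] * D U.
Proof.
rewrite /ptQ -mulrA -/B -/U -/P !expr2; move: P U => P' U'.
by rewrite mderivD [D (_ * _.[_])]mderivM mderiv_horner !mderivE; ring.
Qed.

(** The choice of h turns D (U^2 h(U)) into U^2 g'(U) D U, so h disappears and the Jacobian matrix
    involves g only through g(U) and g'(U). *)
Lemma mderiv_ptR g : D (ptR (MC (polyh g)) gX gY gZ) =
  2%:R * D gX - 6%:R * gX * D gX * gY - 3%:R * gX ^+ 2 * D gY
  - 3%:R * gX ^+ 2 * D gX * gZ - gX ^+ 3 * D gZ
  - U ^+ 2 * (MC g^`()).[U] * D U.
Proof.
have relh : (MC (polyh g)).[U] *+ 2 + U * (MC (polyh g)^`()).[U]
  = U * (MC g^`()).[U].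
  have := congr1 (fun f => (MC f).[U]) (polyh_deriv charF0 g).
  by rewrite rmorphD rmorphMn !rmorphM /= !map_polyX !hornerE.
rewrite /ptR -/B -/U; move: relh.
move: U => U' relh; rewrite mderivB [D (U' ^+ 2 * _)]mderivM mderiv_horner.
have -> : U' ^+ 2 * (MC g^`()).[U'] * D U' =
    U' * ((MC (polyh g)).[U'] *+ 2 + U' * (MC (polyh g)^`()).[U']) * D U'.
  by rewrite relh; ring.
by rewrite !expr2 !exprS expr0 mulr1 !mderivE; ring.
Qed.

End Derivation.

Lemma det_jacobian_Gtuple g :
  \det (\matrix_(i < 3, j < 3) mderiv j (tnth (Gtuple g) i)) = (- 2%:R)%:MP.
Proof.
rewrite det_mx33 /= !mxE !(tnth_nth 0) /= !inordK //=.
rewrite !mderiv_ptR !mderiv_ptQ.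
(* The values of g and g' at x B become arbitrary elements: the determinant is the same constant
   whatever they are. *)
move: (_.[_]) => G'; move: (_.[_]) => G.
rewrite !mderiv_ptP !mderiv_ptU !mderiv_ptB !mderiv_ptA.
rewrite !mderiv_var -!val_eqE /= !inordK //= rmorphN rmorph_nat.
rewrite /ptP /ptB /ptA.
ring.
Qed.

End Jacobian.

(** * Degree of an extension generated by one root *)

Section ExtensionDegree.
Variables (K L : fieldType) (iota : {rmorphism K -> L}) (s : L).
Local Notation "p ^iota" := (map_poly iota p) (at level 2).

(** The basis consists of the powers of s below d. For spanning, the image in L of the abstract
    extension [subFExtend] contains K and s and is closed under subtraction and division, so it is
    all of L; its elements are polynomials in s, to be reduced modulo P. *)
Lemma extension_degree_root (P : {poly K}) (d : nat) :
  size P = d.+1 -> root P^iota s ->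
  (forall c : 'I_d -> K, \sum_(i < d) iota (c i) * s ^+ i = 0 ->
     forall i, c i = 0) ->
  (forall M : set L, (forall k, M (iota k)) -> M s ->
     (forall f g, M f -> M g -> M (f - g)) ->
     (forall f g, M f -> M g -> M (f / g)) -> forall f, M f) ->
  extension_degree (range iota) d.
Proof.
move=> sizeP rootP indep gen; exists (fun i : 'I_d => s ^+ i); split.
  move=> c Kc; have /choice[c' c'E] : forall i, exists k, iota k = c i.
    by move=> i; have [k _ <-] := Kc i; exists k.
  under eq_bigr do rewrite -c'E.
  by move=> /indep c0 i; rewrite -c'E c0 rmorph0.
have P0 : P != 0 by rewrite -size_poly_eq0 sizeP.
move=> f; have [u ->] : exists u : subFExtend iota s P,
    f = subfx_inj u.
  apply: (gen [set f | exists u : subFExtend iota s P,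
    f = subfx_inj u]).
  - move=> k; exists (inj_subfx iota s P k).
    by rewrite subfx_inj_eval // map_polyC hornerC.
  - by exists (subfx_root iota s P); rewrite subfx_inj_root.
  - by move=> _ _ [u ->] [v ->]; exists (u - v); rewrite rmorphB.
  - by move=> _ _ [u ->] [v ->]; exists (u / v); rewrite fmorph_div.
have [q ->] := subfxE u.
rewrite subfx_inj_eval //.
have -> : q^iota.[s] = (q %% P)^iota.[s].
  rewrite [in LHS](divp_eq q P) rmorphD rmorphM /= hornerD hornerM.
  by rewrite (eqP (rootP : _ == 0)) mulr0 add0r.
have szq : (size (q %% P)^iota <= d)%N.
  by rewrite size_map_poly -ltnS -sizeP ltn_modpN0.
exists (fun i => iota (q %% P)`_i) => [i|]; first by exists (q %% P)`_i.
by rewrite (horner_coef_wide _ szq); apply: eq_bigr => i _; rewrite coef_map.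
Qed.

End ExtensionDegree.

Lemma subf_div (F : fieldType) (a b c d : F) :
  b != 0 -> d != 0 -> a / b - c / d = (a * d - c * b) / (b * d).
Proof. by move=> b0 d0; field; rewrite b0 d0. Qed.

(** * The subfield generated by the image of a ring morphism, as a field type *)

Section ImageSubfield.
Variables (D : comNzRingType) (L : fieldType) (phi : {rmorphism D -> L}).

(** With D a polynomial ring and [phi] the substitution of H, this is the field generated by the
    components of H. It is packaged as a type below so that polynomials over it can be formed. *)
Definition in_image_subfield (f : L) : Prop :=
  exists p q : D, phi q != 0 /\ f = phi p / phi q.

Definition image_subfield_pred : pred L := fun f => `[< in_image_subfield f >].

Lemma image_subfield_divring_closed : divring_closed image_subfield_pred.
Proof.
split=> [|f g|f g].
- apply/asboolP; exists 1, 1.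
  by rewrite rmorph1 oner_neq0 divr1.
- move=> /asboolP[p [q [q0 ->]]] /asboolP[p' [q' [q0' ->]]]; apply/asboolP.
  exists (p * q' - p' * q), (q * q'); rewrite !rmorphB !rmorphM /= mulf_neq0 //.
  by split=> //; rewrite subf_div.
- move=> /asboolP[p [q [q0 ->]]] /asboolP[p' [q' [q0' ->]]]; apply/asboolP.
  (* When the divisor vanishes the quotient is 0 by convention, represented as 0 / 1. *)
  have [p0'|p0'] := eqVneq (phi p') 0.
    exists 0, 1; rewrite rmorph1 oner_neq0; split=> //.
    by rewrite p0' mul0r invr0 mulr0 rmorph0 mul0r.
  exists (p * q'), (q * p'); rewrite !rmorphM /= mulf_neq0 //; split=> //.
  by rewrite invf_div mulf_div.
Qed.

HB.instance Definition _ := GRing.isDivringClosed.Build L image_subfield_pred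
  image_subfield_divring_closed.

Record image_subfield := ImageSubfield {
  image_subfield_val : L;
  _ : image_subfield_val \in image_subfield_pred }.

HB.instance Definition _ := [isSub for image_subfield_val].
HB.instance Definition _ := [Choice of image_subfield by <:].
HB.instance Definition _ :=
  [SubChoice_isSubIntegralDomain of image_subfield by <:].
HB.instance Definition _ :=
  [SubIntegralDomain_isSubField of image_subfield by <:].

HB.instance Definition _ := GRing.RMorphism.copy image_subfield_val
  (val : image_subfield -> L).

Lemma range_image_subfield :
  range image_subfield_val = [set f | in_image_subfield f].
Proof.
apply/seteqP; split=> [_ [[f fP] _ <-]|f fP] //=; first exact/asboolP.
have fP' : f \in image_subfield_pred by apply/asboolP.
by exists (ImageSubfield fP').
Qed.

Lemma image_subfield_incl_subproof d : phi d \in image_subfield_pred.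
Proof. by apply/asboolP; exists d, 1; rewrite rmorph1 oner_neq0 divr1. Qed.

Definition image_incl (d : D) : image_subfield :=
  ImageSubfield (image_subfield_incl_subproof d).

Lemma image_incl_zmod_morphism : zmod_morphism image_incl.
Proof. by move=> a b; apply/val_inj; rewrite rmorphB /= rmorphB. Qed.

Lemma image_incl_monoid_morphism : monoid_morphism image_incl.
Proof.
by split=> [|a b]; apply/val_inj; rewrite ?rmorph1 ?rmorphM /= ?rmorph1 ?rmorphM.
Qed.

HB.instance Definition _ := GRing.isZmodMorphism.Build D image_subfield
  image_incl image_incl_zmod_morphism.
HB.instance Definition _ := GRing.isMonoidMorphism.Build D image_subfield
  image_incl image_incl_monoid_morphism.

End ImageSubfield.

Lemma fractionE (D : idomainType) (f : {fraction D}) :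
  exists a b : D, b != 0 /\ f = tofrac a / tofrac b.
Proof.
elim/quotW: f => x; exists (\n_x), (\d_x); rewrite denom_ratioP; split=> //.
unlock FracField.tofrac; rewrite -[X in _ / X]/(\pi_({fraction D}) _)%qT.
rewrite -[(_)^-1]FracField.pi_inv -[RHS]FracField.pi_mul.
rewrite /FracField.mulf /FracField.invf.
by rewrite !numden_Ratio ?oner_neq0 ?denom_ratioP // mulr1 mul1r Ratio_numden.
Qed.

(** * Polynomial identities and linear independence in characteristic zero *)

Section CharZero.
Variable F : fieldType.
Hypothesis charF0 : forall n, n.+1%:R != 0 :> F.

Lemma natr_inj_char0 : injective (fun n : nat => n%:R : F).
Proof.
move=> m n /eqP; wlog lemn : m n / (m <= n)%N.
  by move=> H; case: (leqP m n) => [|/ltnW] mn; [|rewrite eq_sym]; move/H => ->.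
rewrite eq_sym -subr_eq0 -natrB //.
case E : (n - m)%N => [|k]; last by rewrite (negPf (charF0 k)).
by move=> _; apply/eqP; rewrite eqn_leq lemn -subn_eq0 E.
Qed.

Lemma poly_eq0_horner (p : {poly F}) : (forall t, p.[t] = 0) -> p = 0.
Proof.
move=> p0; apply/eqP; apply: contraT => pn0.
have := @max_poly_roots _ p [seq i%:R | i <- iota 0 (size p)] pn0.
rewrite size_map size_iota ltnn; apply.
  by apply/allP => x _; apply/rootP.
by rewrite map_inj_uniq ?iota_uniq //; exact: natr_inj_char0.
Qed.

(** Uniqueness of digits in base N, by reduction modulo N and induction; it separates the exponents
    in the Kronecker substitution. *)
Lemma digits_inj (n N : nat) (a b : 'I_n -> nat) :
  (forall i, a i < N)%N -> (forall i, b i < N)%N ->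
  (\sum_(i < n) a i * N ^ i = \sum_(i < n) b i * N ^ i)%N -> a =1 b.
Proof.
elim: n a b => [|n IH] a b aN bN; first by move=> _ [].
have N0 : (0 < N)%N by apply: leq_trans (aN ord0).
rewrite !big_ord_recl !expn0 !muln1 => E.
have S (c : 'I_n.+1 -> nat) : (\sum_(i < n) c (lift ord0 i) * N ^ lift ord0 i =
    (\sum_(i < n) c (lift ord0 i) * N ^ i) * N)%N.
  by rewrite big_distrl; apply: eq_bigr => i _ /=; rewrite -mulnA -expnSr.
rewrite !S in E.
have E0 : a ord0 = b ord0.
  have := congr1 (modn^~ N) E.
  by rewrite ![(_ ord0 + _)%N]addnC !modnMDl !modn_small.
have E1 : forall i, a (lift ord0 i) = b (lift ord0 i).
  apply: IH => //.
  move/eqP: E; rewrite E0 eqn_add2l eqn_pmul2r // => /eqP; exact.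
by move=> i; case: (unliftP ord0 i) => [j ->|->].
Qed.

(* Kronecker substitution 'X_i := t ^ (N ^ i): for N large the monomials of p
   get distinct exponents. *)
Lemma mpoly_eq0_meval (n : nat) (p : {mpoly F[n]}) :
  (forall v, p.@[v] = 0) -> p = 0.
Proof.
move=> p0; pose N := msize p.
pose kappa (m : 'X_{1..n}) := (\sum_(i < n) m i * N ^ i)%N.
pose u : {poly F} := \sum_(m <- msupp p) p@_m *: 'X^(kappa m).
have u0 : u = 0.
  apply: poly_eq0_horner => t; rewrite -[RHS](p0 (fun i => t ^+ (N ^ i))).
  rewrite mevalE horner_sum; apply: eq_bigr => m _.
  rewrite hornerZ hornerXn -prodrXr; congr (_ * _).
  by apply: eq_bigr => i _; rewrite -exprM mulnC.
apply/mpolyP => m; rewrite mcoeff0.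
have [mp|/memN_msupp_eq0 //] := boolP (m \in msupp p).
have := congr1 (fun q : {poly F} => q`_(kappa m)) u0.
rewrite /u coef0 coef_sum (bigD1_seq m) ?msupp_uniq //= coefZ coefXn eqxx mulr1.
rewrite big_seq_cond big1 ?addr0 // => m' /andP[m'p m'm].
rewrite coefZ coefXn; case: eqP => [E|_]; last by rewrite mulr0.
case/eqP: m'm; apply/mnmP; apply: (@digits_inj n N) => [i|i|].
- by apply: leq_ltn_trans (msize_mdeg_lt m'p); rewrite mdegE (bigD1 i) //= leq_addr.
- by apply: leq_ltn_trans (msize_mdeg_lt mp); rewrite mdegE (bigD1 i) //= leq_addr.
- by [].
Qed.

Lemma size_deriv_char0 (p : {poly F}) : (1 < size p)%N -> p^`() != 0.
Proof.
case E : (size p) => [|[|k]] // _.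
apply/eqP => /(congr1 (fun q : {poly F} => q`_k)); rewrite coef0 coef_deriv.
rewrite -mulr_natr => /eqP; rewrite mulf_eq0 (negPf (charF0 k)) orbF.
by have := lead_coef_eq0 p; rewrite lead_coefE E /= => ->; rewrite -size_poly_eq0 E.
Qed.

(* Modulo W only the constant terms of the pi i survive; they have to vanish by
   degree, and the relation can be divided by W. *)
Lemma comp_poly_sum_eq0 (W : {poly F}) (d : nat) (pi : 'I_d -> {poly F}) :
  size W = d.+1 -> \sum_(i < d) (pi i \Po W) * 'X^i = 0 -> forall i, pi i = 0.
Proof.
move=> sW; move: {2}(\max_i size (pi i)) (leqnn (\max_i size (pi i))) => n.
elim: n pi => [|n IH] pi.
  by move=> /bigmax_leqP le0 _ i; apply/eqP; rewrite -size_poly_leq0 le0.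
move=> /bigmax_leqP len.
have piE i : pi i = drop_poly 1 (pi i) * 'X + ((pi i)`_0)%:P.
  by rewrite -[LHS](poly_take_drop 1) addrC; congr (_ + _); rewrite ?expr1 //;
    apply/polyP => j; rewrite coef_take_poly coefC; case: j.
pose P0 : {poly F} := \sum_(i < d) (pi i)`_0 *: 'X^i.
pose P1 : {poly F} := \sum_(i < d) (drop_poly 1 (pi i) \Po W) * 'X^i.
have -> : \sum_(i < d) (pi i \Po W) * 'X^i = P0 + W * P1.
  rewrite /P0 /P1 mulr_sumr -big_split; apply: eq_bigr => i _ /=.
  by rewrite {1}piE comp_polyD comp_polyM comp_polyX comp_polyC -mul_polyC; ring.
move=> E.
have P10 : P1 = 0.
  apply/eqP; apply: contraT => P1n0.
  have sP0 : (size P0 <= d)%N.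
    apply: (leq_trans (size_sum _ _ _)); apply/bigmax_leqP => i _.
    by apply: (leq_trans (size_scale_leq _ _)); rewrite size_polyXn.
  have sWP1 : (d < size (W * P1)%R)%N.
    have Wn0 : W != 0 by rewrite -size_poly_eq0 sW.
    rewrite size_mul // sW addSn -[X in (X < _)%N]addn0 ltn_add2l.
    by rewrite size_poly_gt0.
  move: E => /eqP; rewrite addr_eq0 => /eqP E; move: sP0; rewrite E size_polyN.
  by rewrite leqNgt sWP1.
have P00 : P0 = 0 by move: E; rewrite P10 mulr0 addr0.
have IHd := IH (fun i => drop_poly 1 (pi i)) _ P10.
move=> i; rewrite piE IHd ?mul0r ?add0r.
  have := congr1 (fun q : {poly F} => q`_i) P00.
  rewrite /P0 coef_sum coef0 (bigD1 i) //= coefZ coefXn eqxx mulr1.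
  rewrite big1 ?addr0 => [->|j ji] //.
  by rewrite coefZ coefXn eq_sym val_eqE (negPf ji) mulr0.
by apply/bigmax_leqP => j _; rewrite size_drop_poly leq_subLR add1n len.
Qed.

End CharZero.

(** * The polynomial W: values, derivative, degree *)

Section CharZeroInverse.
Variable F : fieldType.
Hypothesis charF0 : forall n, n.+1%:R != 0 :> F.
Implicit Types (g : {poly F}) (p q s : F).

Definition Wpoly g p q : {poly F} :=
  (2%:R * p) *: 'X^3 - q *: 'X^2 + 2%:R *: 'X
  + (p *: 'X) ^+ 2 * ((g - polyh g) \Po (p *: 'X)).

Lemma horner_Wpoly g p q s : (Wpoly g p q).[s] = invW g (polyh g) p q s.
Proof.
rewrite /Wpoly !(hornerD, hornerN, hornerM, hornerZ, hornerXn, hornerX, horner_exp).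
rewrite horner_comp !(hornerD, hornerN, hornerZ, hornerX) /invW.
by rewrite (mulrC p s).
Qed.

(** With u = s p, the relation (u^2 h)' = u^2 g' reduces the u-derivative of u^2 (g - h) to 2 u g.
    Hence W' vanishes exactly where the inversion formulas break down. *)
Lemma horner_deriv_Wpoly g p q s :
  (Wpoly g p q)^`().[s] = 2%:R * inva g p q s.
Proof.
have relh : 2%:R * (polyh g).[s * p] + (s * p) * (polyh g)^`().[s * p]
    = (s * p) * g^`().[s * p].
  have := congr1 (horner^~ (s * p)) (polyh_deriv charF0 g).
  by rewrite !(hornerD, hornerM, hornerX, hornerMn) mulr_natl.
rewrite /Wpoly !derivE deriv_comp !derivE.
rewrite !(hornerD, hornerN, hornerM, hornerMn, hornerZ, hornerXn,
  hornerX, hornerC, horner_comp, horner_exp).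
rewrite (mulrC p s) /inva; move: relh.
move: g.[_] (polyh g).[_] g^`().[_] (polyh g)^`().[_] => G H G' H' relh.
apply/eqP; rewrite -subr_eq0; apply/eqP.
(* The difference of the two sides is a multiple of the relation between h and g. *)
transitivity (p * (s * p) * ((s * p) * G' - (2%:R * H + (s * p) * H'))).
  by ring.
by rewrite relh subrr mulr0.
Qed.

Lemma coef_Wpoly g p q i : (Wpoly g p q)`_i =
  2%:R * p *+ (i == 3) - q *+ (i == 2) + 2%:R *+ (i == 1%N)
  + (if (i < 2)%N then 0 else p ^+ i * (g - polyh g)`_(i - 2)).
Proof.
have E : (p *: 'X) ^+ 2 * ((g - polyh g) \Po (p *: 'X)) =
  (\poly_(j < size (g - polyh g)) (p ^+ (j + 2) * (g - polyh g)`_j)) * 'X^2.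
  rewrite comp_polyE poly_def mulr_suml mulr_sumr; apply: eq_bigr => j _.
  rewrite -scalerAr -exprD exprZn scalerA -scalerAl -exprD [(2 + _)%N]addnC.
  by rewrite mulrC.
rewrite /Wpoly E !(coefD, coefN, coefZ, coefXn, coefX) coefMXn.
rewrite !mulr_natr; congr (_ + _); case: ltnP => // i2.
rewrite -[_ - _ in RHS]coefB coef_poly subnK //; case: ltnP => // ki.
by rewrite [X in _ * X]nth_default ?mulr0.
Qed.

Lemma coef_sub_polyh g i : (g - polyh g)`_i = g`_i * (2%:R / (i + 2)%:R).
Proof.
rewrite coefB coef_polyh -{1}[g`_i]mulr1 -mulrBr; congr (_ * _).
have i0 : (i + 2)%:R != 0 :> F by rewrite addn2.
by apply: (mulIf i0); rewrite mulrBl !divfK // mul1r -natrB ?leq_addr // addKn.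
Qed.

(** The term of g of degree j contributes to W in degree j + 2. As g has degree at least 2, its top
    term lands in degree at least 4, above the cubic term 2 p s^3, and cannot cancel. *)
Lemma size_Wpoly g p q :
  p != 0 -> (2 < size g)%N -> size (Wpoly g p q) = (size g).+2.
Proof.
move=> p0 g2; apply/eqP; rewrite eqn_leq; apply/andP; split.
  apply/leq_sizeP => -[|[|i]] // gi; rewrite coef_Wpoly /=.
  have i2 : (1 < i)%N by exact: ltnW (leq_trans g2 gi).
  rewrite !eqSS !gtn_eqF // ?(ltnW i2) // !mulr0n subrr !add0r.
  rewrite -[i.+2]addn2 addnK coef_sub_polyh nth_default ?mul0r ?mulr0 //.
rewrite ltnNge; apply/negP => /leq_sizeP /(_ (size g).+1 (leqnn _)).
rewrite coef_Wpoly.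
move: g2 (lead_coef_eq0 g); rewrite lead_coefE -size_poly_eq0.
case: (size g) => [|[|[|k]]] // _.
have : p ^+ k.+4 != 0 by rewrite expf_neq0.
move: (p ^+ k.+4) => pk pk0 /=.
rewrite !mulr0n subrr !add0r -[k.+4]addn2 addnK coef_sub_polyh => gk.
move/eqP; apply/negP.
by rewrite !mulf_neq0 ?pk0 ?gk ?invr_eq0 ?addn2 ?charF0.
Qed.

End CharZeroInverse.

(** * Independence of the powers of s over the field generated by the map *)

Section GenericDegree.
Variable F : fieldType.
Hypothesis charF0 : forall n, n.+1%:R != 0 :> F.
Local Notation MP := {mpoly F[3]}.
Local Notation MC := (@mpolyC 3 F).
Local Notation gX := (gX F).
Local Notation gY := (gY F).
Local Notation gZ := (gZ F).
Implicit Types (g : {poly F}) (x y z p q r s : F).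

Definition vec3 x y z : 'I_3 -> F := fun i => [:: x; y; z]`_i.

Lemma vec3E x y z : (vec3 x y z (inord 0) = x) *
  (vec3 x y z (inord 1) = y) * (vec3 x y z (inord 2) = z).
Proof. by rewrite /vec3 !inordK. Qed.

Lemma map_meval_polyC g (v : 'I_3 -> F) : map_poly (meval v) (map_poly MC g) = g.
Proof.
by rewrite -map_poly_comp map_poly_id // => c _ /=; rewrite mevalC.
Qed.

Lemma meval_Gtuple g x y z i : (tnth (Gtuple g) i).@[vec3 x y z] =
  vec3 (ptP x y z) (ptQ g x y z) (ptR (polyh g) x y z) i.
Proof.
have vX : gX.@[vec3 x y z] = x by rewrite mevalXU vec3E.
have vY : gY.@[vec3 x y z] = y by rewrite mevalXU vec3E.
have vZ : gZ.@[vec3 x y z] = z by rewrite mevalXU vec3E.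
case: i => [[|[|[|//]]] i3]; rewrite (tnth_nth 0) /vec3 /=.
- by rewrite rmorph_ptP /= vX vY vZ.
- by rewrite rmorph_ptQ /= map_meval_polyC vX vY vZ.
- by rewrite rmorph_ptR /= map_meval_polyC vX vY vZ.
Qed.

Lemma meval_comp_Gtuple g (c : MP) x y z : (c \mPo Gtuple g).@[vec3 x y z] =
  c.@[vec3 (ptP x y z) (ptQ g x y z) (ptR (polyh g) x y z)].
Proof.
by rewrite comp_mpoly_meval; apply: meval_eq => i; exact: meval_Gtuple.
Qed.

Definition section_poly (c : MP) p q : {poly F} :=
  \sum_(m <- msupp c)
     (c@_m * p ^+ m (inord 0) * q ^+ m (inord 1)) *: 'X^(m (inord 2)).

Lemma horner_section_poly c p q r :
  (section_poly c p q).[r] = c.@[vec3 p q r].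
Proof.
rewrite mevalE horner_sum; apply: eq_bigr => m _.
rewrite hornerZ hornerXn !big_ord_recl big_ord0 /vec3 /= mulr1 !mulrA.
by congr (_ * _ ^+ m _ * _ ^+ m _ * _ ^+ m _); apply/val_inj; rewrite /= inordK.
Qed.

Lemma ptP_var_neq0 : ptP gX gY gZ != 0.
Proof.
apply/eqP => /(congr1 (meval (vec3 0 0 1))); rewrite meval0 rmorph_ptP /=.
rewrite !mevalXU !vec3E /ptP /ptB /ptA.
by rewrite !(mul0r, addr0, expr0n, expr1n, mul1r) => /eqP; rewrite oner_eq0.
Qed.

(* The relation between the powers of s = gX / A, cleared of denominators; it is
   evaluated at the points with given (P, Q, s), where R = W(s). *)
Lemma Gtuple_pow_indep g (c : 'I_(size g).+1 -> MP) : (2 < size g)%N ->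
  \sum_i (c i \mPo Gtuple g) * (gX ^+ i * ptA gX gY ^+ ((size g).+1 - i)) = 0 ->
  forall i, c i \mPo Gtuple g = 0.
Proof.
move=> g2 rel.
have c0 p q r i : p != 0 -> (c i).@[vec3 p q r] = 0.
  move=> p0; rewrite -horner_section_poly.
  suff -> : section_poly (c i) p q = 0 by rewrite horner0.
  move: i; apply: (@comp_poly_sum_eq0 _ (Wpoly g p q)).
    exact: size_Wpoly.
  (* A value s comes from a point only if [inva] is nonzero there. Multiplying by W', which is 2
     [inva], makes the identity trivial at the other values of s. *)
  have W'0 : (Wpoly g p q)^`() != 0 by rewrite size_deriv_char0 // size_Wpoly.
  apply: (mulIf W'0); rewrite mul0r; apply: poly_eq0_horner => // s.
  rewrite hornerM horner_deriv_Wpoly //.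
  have [->|a0] := eqVneq (inva g p q s) 0; first by rewrite !mulr0.
  suff -> : (\sum_i (section_poly (c i) p q \Po Wpoly g p q) * 'X^i).[s] = 0.
    by rewrite mul0r.
  have := congr1 (meval (vec3 (invx g p q s) (invy g p q s) (invz g p q s))) rel.
  rewrite meval0 !raddf_sum /= horner_sum => rel'.
  (* This is A ^ d at the chosen point, the factor by which the relation was cleared of
     denominators. *)
  have ad0 : (inva g p q s)^-1 ^+ (size g).+1 != 0.
    by rewrite expf_neq0 // invr_eq0.
  apply: (mulIf ad0); rewrite mul0r mulr_suml -[RHS]rel'; apply: eq_bigr => i _.
  rewrite mevalM meval_comp_Gtuple ptP_inv // ptQ_inv // ptR_inv //.
  rewrite hornerM hornerXn horner_comp horner_section_poly horner_Wpoly -mulrA.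
  congr (_ * _); rewrite mevalM !rmorphXn /= rmorph_ptA /= !mevalXU.
  rewrite !vec3E ptA_inv // /invx exprMn -mulrA -exprD subnKC //.
  exact: ltnW.
(* The coefficients are known to vanish where P is nonzero; multiplying by P makes the identity hold
   at every point. *)
move=> i; have P0 := ptP_var_neq0.
apply: (mulIf P0); rewrite mul0r; apply: (mpoly_eq0_meval charF0) => v.
have vE : v =1 vec3 (v (inord 0)) (v (inord 1)) (v (inord 2)).
  by case=> [[|[|[|//]]] i3]; rewrite /vec3 /=; congr v; apply/val_inj;
    rewrite /= inordK.
rewrite (meval_eq _ vE) mevalM meval_comp_Gtuple.
rewrite rmorph_ptP /= !mevalXU !vec3E.
have [->|p0] := eqVneq (ptP (v (inord 0)) (v (inord 1)) (v (inord 2))) 0.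
  by rewrite mulr0.
by rewrite c0 // mul0r.
Qed.

End GenericDegree.

(** * Compatibility of h and W with field morphisms *)

Section WpolyMorphism.
Variables (F1 F2 : fieldType) (f : {rmorphism F1 -> F2}).

Lemma map_polyh g : map_poly f (polyh g) = polyh (map_poly f g).
Proof.
apply/polyP => i; rewrite coef_map !coef_polyh coef_map /=.
by rewrite rmorphM fmorph_div !rmorph_nat.
Qed.

Lemma map_Wpoly g p q :
  map_poly f (Wpoly g p q) = Wpoly (map_poly f g) (f p) (f q).
Proof.
rewrite /Wpoly rmorphD rmorphM rmorphXn /= map_comp_poly rmorphB /= map_polyh.
rewrite !map_polyZ map_polyX; congr (_ + _).
rewrite rmorphD rmorphB /= !map_polyZ !map_polyXn map_polyX.
by rewrite rmorphM !rmorph_nat.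
Qed.

End WpolyMorphism.

(** * The degree of the function field over the subfield generated by the map *)

Section FunctionField.
Variables (F : fieldType) (L : fieldType) (tf : {rmorphism {mpoly F[3]} -> L}).
Hypothesis charF0 : forall n, n.+1%:R != 0 :> F.
Hypothesis tf_inj : injective tf.
Hypothesis tf_gen : forall f, exists a b, b != 0 /\ f = tf a / tf b.
Variable g : {poly F}.
Hypothesis g2 : (2 < size g)%N.
Local Notation MP := {mpoly F[3]}.
Local Notation MC := (@mpolyC 3 F).
Local Notation gX := (gX F).
Local Notation gY := (gY F).
Local Notation gZ := (gZ F).
Local Notation H := (Gtuple g).

Definition pullback : {rmorphism MP -> L} :=
  GRing.RMorphism.clone _ _ (tf \o comp_mpoly H) _.

Lemma pullbackE d : pullback d = tf (d \mPo H).
Proof. by []. Qed.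

Local Opaque pullback.

Local Notation K := (image_subfield pullback).
Local Notation toL := (@image_subfield_val _ _ pullback).
Local Notation incl := (image_incl pullback).

Let x := tf gX.
Let y := tf gY.
Let z := tf gZ.
Let A := ptA x y.
Let s := x / A.
Let gL := map_poly (tf \o MC) g.
Let gK := map_poly (incl \o MC) g.

Let tf0 d : (tf d == 0) = (d == 0).
Proof. by rewrite -(rmorph0 tf) (inj_eq tf_inj). Qed.

Let A0 : A != 0.
Proof.
rewrite /A -rmorph_ptA tf0; apply/eqP => /(congr1 (meval (vec3 0 0 0))).
rewrite meval0 rmorph_ptA /= !mevalXU !vec3E /ptA mulr0 addr0.
by move/eqP; rewrite oner_eq0.
Qed.

Let charK0 n : n.+1%:R != 0 :> K.
Proof.
rewrite -(rmorph_nat incl) -val_eqE /= pullbackE /= !rmorph_nat -(rmorph_nat tf) tf0.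
by rewrite -(rmorph_nat MC) mpolyC_eq0 charF0.
Qed.

Lemma pullback_const c : pullback c%:MP = tf c%:MP.
Proof. by rewrite pullbackE /= comp_mpolyC. Qed.

Lemma pullback_X : [/\ pullback 'X_(inord 0) = ptP x y z,
  pullback 'X_(inord 1) = ptQ gL x y z &
  pullback 'X_(inord 2) = ptR (polyh gL) x y z].
Proof.
rewrite !pullbackE !comp_mpolyXU /= !inordK //=.
rewrite rmorph_ptP rmorph_ptQ rmorph_ptR -!map_poly_comp /= -map_polyh.
by [].
Qed.

Let map_gK : map_poly toL gK = gL.
Proof.
by rewrite -map_poly_comp; apply: eq_map_poly => c /=; rewrite pullback_const.
Qed.

Let size_gK : size gK = size g.
Proof. exact: size_map_poly. Qed.

Lemma fibre_poly_root :
  root (map_poly toL (Wpoly gK (incl 'X_(inord 0)) (incl 'X_(inord 1))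
     - (incl 'X_(inord 2))%:P)) s.
Proof.
have [P0 P1 P2] := pullback_X.
have EB p r : map_poly toL (p - r%:P) = map_poly toL p - (toL r)%:P.
  by rewrite rmorphB /= map_polyC.
have EW p q : map_poly toL (Wpoly gK p q) = Wpoly gL (toL p) (toL q).
  by rewrite map_Wpoly map_gK.
apply/rootP; rewrite EB EW /= P0 P1 P2.
by rewrite hornerD hornerN hornerC horner_Wpoly invW_ratio // subrr.
Qed.

Lemma size_fibre_poly :
  size (Wpoly gK (incl 'X_(inord 0)) (incl 'X_(inord 1))
     - (incl 'X_(inord 2))%:P) = (size g).+2.
Proof.
have X0 : incl 'X_(inord 0) != 0.
  have [P0 _ _] := pullback_X; rewrite -val_eqE /= P0 -rmorph_ptP tf0.
  exact: ptP_var_neq0.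
have sW : size (Wpoly gK (incl 'X_(inord 0)) (incl 'X_(inord 1))) = (size g).+2.
  by rewrite size_Wpoly ?size_gK.
by rewrite size_polyDl // sW size_polyN (leq_ltn_trans (size_polyC_leq1 _)).
Qed.

(** Multiplying by a common denominator of the coefficients and by the d-th power of A, d =
    [(size g).+1], turns a relation in L into the polynomial relation of [Gtuple_pow_indep]. *)
Lemma ratio_pow_indep (c : 'I_(size g).+1 -> K) :
  \sum_i toL (c i) * s ^+ i = 0 -> forall i, c i = 0.
Proof.
move=> rel.
have /choice[nd ndP] : forall i, exists nd : MP * MP,
    pullback nd.2 != 0 /\ toL (c i) = pullback nd.1 / pullback nd.2.
  move=> i; have /asboolP[a [b ?]] : toL (c i) \in image_subfield_pred pullback.
    exact: valP.
  by exists (a, b).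
pose c' i := (nd i).1 * \prod_(j | j != i) (nd j).2.
pose Q := \prod_j (nd j).2.
have Q0 : pullback Q != 0.
  by rewrite rmorph_prod; apply/prodf_neq0 => j _; case: (ndP j).
have c'E i : pullback (c' i) = pullback Q * toL (c i).
  have [q0 ->] := ndP i.
  rewrite /Q (bigD1 i) //= /c' !rmorphM mulrAC mulrCA.
  by rewrite mulfV // mulr1.
clearbody c'.
move=> i; apply/val_inj/(mulfI Q0); rewrite -c'E mulr0.
suff -> : pullback (c' i) = tf 0 by rewrite rmorph0.
rewrite pullbackE /=; congr (tf _); move: i; apply: (Gtuple_pow_indep charF0 g2).
apply: tf_inj; rewrite rmorph0 rmorph_sum /=.
have E : pullback Q * A ^+ (size g).+1 * \sum_i toL (c i) * s ^+ i = 0.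
  by rewrite rel mulr0.
rewrite -[RHS]E mulr_sumr; apply: eq_bigr => i _.
rewrite mulrACA -c'E pullbackE rmorphM; congr (_ * _).
rewrite rmorphM !rmorphXn /= rmorph_ptA -/x -/y -/A /s expr_div_n mulrCA.
congr (_ * _); apply: (mulIf (expf_neq0 i A0)).
by rewrite mulfVK ?expf_neq0 // -exprD subnK // ltnW.
Qed.

(** The inversion formulas express y, x and z rationally in P, Q and s, and every element of L is a
    quotient of polynomials in x, y, z. *)
Lemma ratio_generates (M : set L) : (forall k, M (toL k)) -> M s ->
  (forall f h, M f -> M h -> M (f - h)) ->
  (forall f h, M f -> M h -> M (f / h)) -> forall f, M f.
Proof.
move=> MK Ms MB Mdiv.
have Mpull d : M (pullback d) by exact: (MK (incl d)).
have M0 : M 0 by rewrite -(rmorph0 pullback).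
have M1 : M 1 by rewrite -(rmorph1 pullback).
have MN f : M f -> M (- f) by move=> Mf; rewrite -[- f]add0r; exact: MB.
have MD f h : M f -> M h -> M (f + h).
  by move=> Mf Mh; rewrite -[h]opprK; apply/MB => //; exact: MN.
have MV f : M f -> M f^-1 by move=> Mf; rewrite -[f^-1]mul1r; exact: Mdiv.
have MM f h : M f -> M h -> M (f * h).
  by move=> Mf Mh; rewrite -[h]invrK; apply/Mdiv => //; exact: MV.
have MX f n : M f -> M (f ^+ n).
  by move=> Mf; elim: n => [|n IH]; rewrite ?expr0 ?exprS //; exact: MM.
have Mn n : M n%:R by rewrite -(rmorph_nat pullback).
have Mc c : M (tf c%:MP) by rewrite -pullback_const.
have [P0 P1 P2] := pullback_X.
have MP' : M (ptP x y z) by rewrite -P0.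
have MQ : M (ptQ gL x y z) by rewrite -P1.
have Mg u : M u -> M gL.[u].
  move=> Mu; rewrite horner_coef; apply: big_ind => // i _; apply: MM; last exact: MX.
  by rewrite coef_map; exact: Mc.
have Ma : M (inva gL (ptP x y z) (ptQ gL x y z) s).
  by rewrite /inva; apply (MD); [apply (MD); [apply (MB)|]|]; repeat first
    [exact: Ms | exact: Mn | exact: MP' | exact: MQ
    | apply (Mg) | apply (MM) | apply (MX)].
have My : M y.
  rewrite -(invy_ratio gL z A0) /invy; apply (MB); [apply (MB)|]; repeat first
    [exact: Ms | exact: Mn | exact: MP' | exact: MQ
    | apply (Mg) | apply (MM) | apply (MX)].
have Mx : M x.
  by rewrite -(invx_ratio gL z A0) /invx; exact: Mdiv.
have Mz : M z.
  rewrite -(invz_ratio gL z A0) /invz -/A -/s.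
  rewrite [invx _ _ _ _]invx_ratio // [invy _ _ _ _]invy_ratio //.
  apply (MM); last exact: MX.
  apply (MB); first exact: MM.
  by apply (MM); [exact: MX | apply (MD) => //; apply (MM) => //; exact: MM].
have Mtf d : M (tf d).
  rewrite (mpolyE d) rmorph_sum; apply: big_ind => // m _.
  rewrite /= -mul_mpolyC rmorphM; apply (MM); first exact: Mc.
  rewrite mpolyXE_id rmorph_prod; apply: big_ind => // i _ /=.
  rewrite rmorphXn; apply (MX); case: i => [[|[|[|//]]] i3] /=.
  - move: Mx; rewrite /x /gX; congr (M (tf 'X__)).
    by apply/val_inj; rewrite /= inordK.
  - move: My; rewrite /y /gY; congr (M (tf 'X__)).
    by apply/val_inj; rewrite /= inordK.
  - move: Mz; rewrite /z /gZ; congr (M (tf 'X__)).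
    by apply/val_inj; rewrite /= inordK.
by move=> f; have [a [b [_ ->]]] := tf_gen f; exact: Mdiv.
Qed.

Lemma extension_degree_Gtuple :
  extension_degree [set f | exists p q, q \mPo H != 0 /\
    f = tf (p \mPo H) / tf (q \mPo H)] (size g).+1.
Proof.
have -> : [set f | exists p q, q \mPo H != 0 /\
    f = tf (p \mPo H) / tf (q \mPo H)] = range toL.
  rewrite range_image_subfield; apply/seteqP.
  by split=> f [p [q [q0 ->]]]; exists p, q; move: q0; rewrite !pullbackE tf0.
exact: (extension_degree_root size_fibre_poly fibre_poly_root
  ratio_pow_indep ratio_generates).
Qed.

End FunctionField.

(** * From sequences eta to polynomials g; Keller property and generic degree *)

Lemma fsum_pos_nat (V : nmodType) (f : nat -> V) (n : nat) :
  (forall j, (0 < j)%N -> (n <= j)%N -> f j = 0) ->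
  \sum_(j \in [set j : nat | (0 < j)%N]) f j = \sum_(j < n) f j *+ (j != 0 :> nat).
Proof.
move=> fn; rewrite (@fsbigE _ _ _ _ _ [seq j <- iota 0 n | (0 < j)%N]).
- rewrite big_filter_cond -[X in iota 0 X]subn0 -/(index_iota 0 n) big_mkord big_mkcond.
  apply: eq_bigr => j _; rewrite lt0n.
  by case: eqP => //= j0; rewrite ifT // inE /= lt0n; apply/eqP.
- by rewrite filter_uniq ?iota_uniq.
- by move=> j /=; rewrite mem_filter => /andP[].
- move=> j /= j0; rewrite mem_filter j0 mem_iota add0n /= -leqNgt.
  exact: fn.
Qed.

Lemma horner_map_mpolyC (F : nzRingType) (k n : nat) (g : {poly F})
    (u : {mpoly F[k]}) : (size g <= n)%N ->
  (map_poly (@mpolyC k F) g).[u] = \sum_(j < n) g`_j *: u ^+ j.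
Proof.
move=> gn; rewrite (@horner_coef_wide _ n); last first.
  by rewrite (leq_trans (size_poly _ _)).
by apply: eq_bigr => j _; rewrite coef_map_id0 ?mpolyC0 // mul_mpolyC.
Qed.

Section Links.
Variable R : realType.
Implicit Types (eta : nat -> R) (g : {poly R}).

Lemma charR0 n : n.+1%:R != 0 :> R.
Proof. by rewrite pnatr_eq0. Qed.

Lemma charC0 n : n.+1%:R != 0 :> complex R.
Proof. by rewrite pnatr_eq0. Qed.

(** The summands rewrite as A^2 x^j B^(j + 2) = P^2 (x B)^j and x^(j + 2) B^(j + 2) = (x B)^2 (x
    B)^j. The constant coefficient of g is forced to 0, because the sums start at j = 1. *)
Lemma G_eta_Gtuple eta n : (forall j, (0 < j)%N -> (n <= j)%N -> eta j = 0) ->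
  G_eta eta = Gtuple (\poly_(j < n) (eta j *+ (j != 0)%N)).
Proof.
move=> etan; apply/val_inj => /=.
have EQ : polQ_eta eta = ptQ
    (map_poly (@mpolyC 3 R) (\poly_(j < n) (eta j *+ (j != 0)%N)))
    (gX R) (gY R) (gZ R).
  rewrite /polQ_eta /ptQ; congr (_ + _).
  rewrite (@fsum_pos_nat _ _ n); last by move=> j j0 /etan -> //; rewrite scale0r.
  rewrite (horner_map_mpolyC (n := n)) ?size_poly // mulr_sumr.
  apply: eq_bigr => j _; rewrite coef_poly ltn_ord scalerMnl -scalerAr.
  congr (_ *: _).
  change (ptA (gX R) (gY R) ^+ 2 * gX R ^+ j * ptB (gX R) (gY R) (gZ R) ^+ (j + 2)
    = (ptA (gX R) (gY R) * ptB (gX R) (gY R) (gZ R)) ^+ 2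
      * (gX R * ptB (gX R) (gY R) (gZ R)) ^+ j).
  by move: (ptA _ _) (ptB _ _ _) => a b; rewrite !exprMn exprD; ring.
have ER : polR_eta eta = ptR
    (map_poly (@mpolyC 3 R) (polyh (\poly_(j < n) (eta j *+ (j != 0)%N))))
    (gX R) (gY R) (gZ R).
  rewrite /polR_eta /ptR; congr (_ - _).
  rewrite (@fsum_pos_nat _ _ n); last by move=> j j0 /etan -> //; rewrite mul0r scale0r.
  rewrite (horner_map_mpolyC (n := n)); last first.
    by rewrite (leq_trans (size_poly _ _)) ?size_poly.
  rewrite mulr_sumr; apply: eq_bigr => j _.
  rewrite coef_polyh coef_poly ltn_ord [eta j *+ _ * _]mulrnAl.
  rewrite -[RHS]scalerAr scalerMnl.
  congr (_ *: _).
  change (gX R ^+ (j + 2) * ptB (gX R) (gY R) (gZ R) ^+ (j + 2)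
    = (gX R * ptB (gX R) (gY R) (gZ R)) ^+ 2
      * (gX R * ptB (gX R) (gY R) (gZ R)) ^+ j).
  by rewrite -exprMn -exprD addnC.
by rewrite EQ ER.
Qed.

Lemma keller_Gtuple g : keller (Gtuple g : polymap R 3).
Proof.
exists (- 2%:R); first by rewrite oppr_eq0 pnatr_eq0.
exact: det_jacobian_Gtuple charR0 g.
Qed.

Lemma complexify_Gtuple g :
  complexify (Gtuple g : polymap R 3) = Gtuple (map_poly (real_complex R) g).
Proof.
have mapC h : map_poly (map_mpoly (real_complex R)) (map_poly (@mpolyC 3 R) h)
    = map_poly (@mpolyC 3 _) (map_poly (real_complex R) h).
  rewrite -!map_poly_comp; apply: eq_map_poly => c /=; exact: map_mpolyC.
have mX i : map_mpoly (real_complex R) 'X_i = 'X_i :> {mpoly (complex R)[3]}.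
  exact: map_mpolyX.
apply/val_inj => /=.
by rewrite rmorph_ptP rmorph_ptQ rmorph_ptR /= !mapC map_polyh !mX.
Qed.

Lemma generic_degree_Gtuple g : (2 < size g)%N ->
  generic_degree (Gtuple g : polymap R 3) (size g).+1.
Proof.
move=> g2; set gC := map_poly (real_complex R) g.
have gC2 : (2 < size gC)%N by rewrite size_map_poly.
pose tf := [the {rmorphism {mpoly (complex R)[3]} ->
  {fraction {mpoly (complex R)[3]}}} of @FracField.tofrac _].
have tf_inj : injective tf by move=> a b /eqP; rewrite tofrac_eq => /eqP.
rewrite /generic_degree /ratfield complexify_Gtuple.
rewrite -(size_map_poly (real_complex R)) -/gC.
exact: (extension_degree_Gtuple charC0 tf_inj (@fractionE _) gC2).
Qed.

End Links.

(** * Cardinality bounds through duplicate-free sequences *)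

Section CardinalOfSeq.
Variables (T : choiceType) (S : set T) (m : nat).

Lemma card_le_II_uniq :
  (forall t : seq T, uniq t -> (forall x, x \in t -> S x) -> (size t <= m)%N) ->
  S #<= `I_m.
Proof.
move=> tm; have [/finite_seqP[s Ss]|/(infinite_set_fset m.+1)[B BS mB]] :=
    pselect (finite_set S); last first.
  have := tm (enum_fset B) (fset_uniq _) (fun x xB => BS x xB).
  by rewrite leqNgt mB.
case: s Ss => [|x0 s] Ss.
  by rewrite (_ : S = set0) ?card_ge0 // Ss; apply/seteqP; split=> x.
set t := undup (x0 :: s).
have tS : S = nth x0 t @` `I_(size t).
  rewrite Ss; apply/seteqP; split=> [x /= xs|_ [i /= it <-]].
    by exists (index x t); rewrite /= ?nth_index ?index_mem ?mem_undup.
  by have := mem_nth x0 it; rewrite mem_undup.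
rewrite tS; apply: card_le_trans (card_image_le _ _) _.
rewrite card_le_II; apply: tm; first exact: undup_uniq.
by move=> x; rewrite mem_undup Ss.
Qed.

Lemma card_ge_II_uniq (t : seq T) : uniq t -> size t = m ->
  (forall x, x \in t -> S x) -> `I_m #<= S.
Proof.
case: t => [_ <- _|x0 t ut tm tS]; first by rewrite II0 card_ge0.
have inj : {in `I_m &, injective (nth x0 (x0 :: t))}.
  move=> i j; rewrite !inE /= -tm => im jm /eqP; rewrite nth_uniq //.
  by move/eqP.
rewrite -(card_le_eql (inj_card_eq inj)); apply: subset_card_le.
by move=> _ [i /= im <-]; apply: tS; rewrite mem_nth ?tm.
Qed.

End CardinalOfSeq.

(** * Real fibres and real roots of W *)

Section Fibres.
Variable R : realType.
Implicit Types (g : {poly R}) (x y z p q r s : R) (v w : 'rV[R]_3).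

Definition row3 x y z : 'rV[R]_3 := \row_i vec3 x y z i.

Lemma row3E v : v = row3 (v 0 (inord 0)) (v 0 (inord 1)) (v 0 (inord 2)).
Proof.
apply/rowP=> -[[|[|[|//]]] i3]; rewrite mxE /vec3 /=; congr (v 0 _);
  by apply/val_inj; rewrite /= inordK.
Qed.

Lemma row3_inj x y z x' y' z' : row3 x y z = row3 x' y' z' ->
  [/\ x = x', y = y' & z = z'].
Proof.
move=> /rowP e; have := (e (inord 0), e (inord 1), e (inord 2)).
by rewrite !mxE !vec3E => -[[]].
Qed.

Lemma polymap_eval_Gtuple g x y z : polymap_eval (Gtuple g) (row3 x y z) =
  row3 (ptP x y z) (ptQ g x y z) (ptR (polyh g) x y z).
Proof.
apply/rowP=> i; rewrite !mxE -(meval_Gtuple g x y z i).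
by apply: meval_eq => j; rewrite mxE.
Qed.

Definition ratio v := v 0 (inord 0) / ptA (v 0 (inord 0)) (v 0 (inord 1)).
Definition regular v := ptA (v 0 (inord 0)) (v 0 (inord 1)) != 0.

Lemma ratio_row3 x y z : ratio (row3 x y z) = x / ptA x y.
Proof. by rewrite /ratio !mxE !vec3E. Qed.

Lemma regular_row3 x y z : regular (row3 x y z) = (ptA x y != 0).
Proof. by rewrite /regular !mxE !vec3E. Qed.

Lemma root_ratio g p q r v : regular v -> real_fibre (Gtuple g) (row3 p q r) v ->
  root (Wpoly g p q - r%:P) (ratio v).
Proof.
rewrite [v]row3E; move: (v _ _) (v _ _) (v _ _) => z y x.
rewrite regular_row3 ratio_row3 => A0; rewrite /real_fibre /= polymap_eval_Gtuple.
move=> /row3_inj[<- <- <-]; apply/rootP.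
by rewrite hornerD hornerN hornerC horner_Wpoly invW_ratio // subrr.
Qed.

Lemma ratio_inj g w v v' : regular v -> regular v' ->
  real_fibre (Gtuple g) w v -> real_fibre (Gtuple g) w v' ->
  ratio v = ratio v' -> v = v'.
Proof.
rewrite [w]row3E [v]row3E [v']row3E.
move: (v _ _) (v _ _) (v _ _) => z y x.
move: (v' _ _) (v' _ _) (v' _ _) => z' y' x'.
move: (w _ _) (w _ _) (w _ _) => r q p.
rewrite !regular_row3 !ratio_row3 /real_fibre /= !polymap_eval_Gtuple => A0 A0'.
move=> /row3_inj[eP eQ eR] /row3_inj[eP' eQ' eR'] E.
have -> : x = x'.
  by rewrite -(invx_ratio g z A0) -(invx_ratio g z' A0') E eP eQ eP' eQ'.
have -> : y = y'.
  by rewrite -(invy_ratio g z A0) -(invy_ratio g z' A0') E eP eQ eP' eQ'.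
have -> // : z = z'.
by rewrite -(invz_ratio g z A0) -(invz_ratio g z' A0') E eP eQ eP' eQ'.
Qed.

(** Where A = 0 one has x y = -1, B = y^2 and Q = -2 y. So Q determines y, hence x, and R is then
    affine in z with slope - x^3, which is nonzero. *)
Lemma singular_inj g w v v' : ~~ regular v -> ~~ regular v' ->
  real_fibre (Gtuple g) w v -> real_fibre (Gtuple g) w v' -> v = v'.
Proof.
rewrite [w]row3E [v]row3E [v']row3E.
move: (v _ _) (v _ _) (v _ _) => z y x.
move: (v' _ _) (v' _ _) (v' _ _) => z' y' x'.
move: (w _ _) (w _ _) (w _ _) => r q p.
rewrite !regular_row3 !negbK /real_fibre /= !polymap_eval_Gtuple.
have sing a b c : ptA a b == 0 -> [/\ a != 0, a = - b^-1, ptB a b c = b ^+ 2,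
    ptQ g a b c = - 2%:R * b & ptR (polyh g) a b c =
    5%:R * a - a ^+ 3 * c - b ^+ 2 * (polyh g).[- b]].
  rewrite /ptA => /eqP A0.
  have ab : a * b = - 1 by apply/eqP; rewrite -addr_eq0 addrC A0.
  have a0 : a != 0.
    by apply/eqP => a0; move/eqP: ab; rewrite a0 mul0r eq_sym oppr_eq0 oner_eq0.
  have b0 : b != 0.
    by apply/eqP => b0; move/eqP: ab; rewrite b0 mulr0 eq_sym oppr_eq0 oner_eq0.
  have B : ptB a b c = b ^+ 2.
    by rewrite /ptB /ptA A0 expr0n mul0r add0r -mulrA ab; ring.
  have aB : a * ptB a b c = - b by rewrite B expr2 mulrA ab mulN1r.
  split=> //.
  - by apply: (mulIf b0); rewrite ab mulNr mulVf.
  - rewrite /ptQ -mulrA aB /ptP {1}/ptA A0; ring.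
  - rewrite /ptR aB sqrrN; congr (_ - _).
    have -> : 3%:R * a ^+ 2 * b = 3%:R * a * (a * b) by ring.
    by rewrite ab; ring.
move=> A0 A0'; have [a0 ea eB eQ eR] := sing x y z A0.
have [a0' ea' eB' eQ' eR'] := sing x' y' z' A0'.
move=> /row3_inj[_ <- <-] /row3_inj[_]; rewrite eQ eQ' eR eR'.
have n20 : - 2%:R != 0 :> R by rewrite oppr_eq0 pnatr_eq0.
move=> /(mulfI n20) yy.
have xx : x' = x by rewrite ea ea' yy.
rewrite yy xx => /addIr /addrI /oppr_inj /mulfI -> //.
by rewrite expf_neq0.
Qed.

(** If p is nonzero then A is nonzero on the fibre, which injects into the roots of W - r. If p = 0,
    then W - r is - q s^2 + 2 s - r, nonzero because of its linear term. *)
Lemma fibre_card_le g (m : nat) : (2 < m)%N ->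
  (forall p q r (t : seq R), p != 0 -> uniq t ->
     all (root (Wpoly g p q - r%:P)) t -> (size t <= m)%N) ->
  forall w, real_fibre (Gtuple g) w #<= `I_m.
Proof.
move=> m2 rm w; apply: card_le_II_uniq => t ut tw.
rewrite [w]row3E in tw.
move: (w _ _) (w _ _) (w _ _) tw => r q p tw.
pose t1 := [seq v <- t | regular v].
pose t2 := [seq v <- t | ~~ regular v].
have ut1 : uniq (map ratio t1).
  rewrite map_inj_in_uniq ?filter_uniq // => v v'; rewrite !mem_filter.
  by move=> /andP[rv vt] /andP[rv' vt']; apply: ratio_inj (tw _ vt) (tw _ vt').
have rt1 : all (root (Wpoly g p q - r%:P)) (map ratio t1).
  apply/allP=> s /mapP[v]; rewrite mem_filter => /andP[rv vt] ->.
  exact: root_ratio rv (tw _ vt).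
have t12 : size t = (size t1 + size t2)%N.
  by rewrite !size_filter -(count_predC regular t).
have [p0|p0] := eqVneq p 0; last first.
  have -> : size t = size (map ratio t1); last exact: rm p0 ut1 rt1.
  rewrite t12 size_map; suff -> : t2 = [::] by rewrite addn0.
  apply/eqP; rewrite -(negbK (t2 == _)) -has_filter; apply/hasPn => v vt.
  rewrite negbK; move: (tw v vt); rewrite [v]row3E.
  rewrite regular_row3 /real_fibre /= polymap_eval_Gtuple => /row3_inj[eP _ _].
  by apply: contraNneq p0 => A0; rewrite -eP /ptP A0 mul0r.
(* At most two points with A nonzero, from the quadratic, and at most one with A = 0. *)
apply: leq_trans m2; rewrite t12; apply: (@leq_add _ _ 2 1).
  have W0 : Wpoly g 0 q - r%:P = Poly [:: - r; 2%:R; - q].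
    rewrite /Wpoly mulr0 !scale0r expr0n mul0r addr0 add0r.
    rewrite /= !cons_poly_def -!mul_polyC !polyCN; ring.
  have Wn0 : Wpoly g 0 q - r%:P != 0.
    apply/eqP => /(congr1 (fun P : {poly R} => P`_1)).
    by rewrite W0 coef_Poly coef0 /= => /eqP; rewrite pnatr_eq0.
  rewrite -(size_map ratio) -ltnS; apply: (leq_trans (max_poly_roots Wn0 _ ut1)).
    by rewrite -p0.
  by rewrite W0; exact: size_Poly.
have : uniq t2 by rewrite filter_uniq.
have : forall v, v \in t2 -> v \in t /\ ~~ regular v.
  by move=> v; rewrite mem_filter => /andP[].
case: t2 {t12} => [|a [|b t2]] // tt /= /andP[]; rewrite inE negb_or => /andP[].
have [at1 ra] := tt a (mem_head _ _).
have [bt1 rb] : b \in t /\ ~~ regular b by apply: tt; rewrite !inE eqxx orbT.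
by rewrite (singular_inj ra rb (tw _ at1) (tw _ bt1)) eqxx.
Qed.

Lemma fibre_card_le_degree g : (2 < size g)%N ->
  forall w, real_fibre (Gtuple g) w #<= `I_(size g).+1.
Proof.
move=> g2; apply: fibre_card_le => [|p q r t p0 ut rt]; first exact: leqW.
have sW : size (Wpoly g p q - r%:P) = (size g).+2.
  have sW : size (Wpoly g p q) = (size g).+2 by apply: size_Wpoly => //; exact: charR0.
  by rewrite size_polyDl // sW size_polyN (leq_ltn_trans (size_polyC_leq1 _)).
rewrite -ltnS -sW; apply: max_poly_roots => //.
by rewrite -size_poly_eq0 sW.
Qed.

(** At a simple root [inva] is nonzero, so the inversion formulas give a point of the fibre;
    distinct roots give distinct points since s is recovered as x / A. *)
Lemma fibre_card_ge g p q r (t : seq R) : uniq t ->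
  (forall s, s \in t -> root (Wpoly g p q - r%:P) s /\
     ~~ root (Wpoly g p q)^`() s) ->
  `I_(size t) #<= real_fibre (Gtuple g) (row3 p q r).
Proof.
move=> ut rt.
pose pt s := row3 (invx g p q s) (invy g p q s) (invz g p q s).
have a0 s : s \in t -> inva g p q s != 0.
  move=> /rt[_]; apply: contraNneq => a0; apply/rootP.
  by rewrite horner_deriv_Wpoly ?a0 ?mulr0 //; exact: charR0.
have pt_inj : {in t &, injective pt}.
  move=> s s' st st' /(congr1 ratio).
  by rewrite !ratio_row3 !ratio_inv ?a0.
apply: (@card_ge_II_uniq _ _ _ (map pt t)); rewrite ?size_map ?map_inj_in_uniq //.
move=> _ /mapP[s st ->]; rewrite /real_fibre /= polymap_eval_Gtuple.
rewrite ptP_inv ?a0 // ptQ_inv ?a0 // ptR_inv ?a0 // -horner_Wpoly.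
have [/rootP + _] := rt s st.
by rewrite hornerD hornerN hornerC => /eqP; rewrite subr_eq0 => /eqP ->.
Qed.

End Fibres.

(** * Counting real roots with Rolle's theorem; the bound four for [G_d] *)

Section RealRoots.
Variable R : realType.
Implicit Types (g P : {poly R}) (p q r x : R) (t : seq R).

(** Rolle's theorem between consecutive roots; requiring the new roots to lie after x is what keeps
    them ordered in the induction. *)
Lemma rolle_path P x t : path <%R x t -> all (root P) (x :: t) ->
  exists t', [/\ size t' = size t, path <%R x t' & all (root P^`()) t'].
Proof.
elim: t x => [|y t IH] x; first by exists [::].
move=> /= /andP[xy yt] /and3P[Px Py Pt].
have [|t' [st' yt' rt']] := IH y yt; first by rewrite /= Py.
have [c] := poly_rolle xy (etrans (eqP Px) (esym (eqP Py))).
rewrite in_itv /= => /andP[xc cy] Pc; exists (c :: t') => /=; split.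
- by rewrite st'.
- rewrite xc; case: t' yt' {st' rt'} => //= z t' /andP[yz ->].
  by rewrite (lt_trans cy yz).
- by rewrite rt' andbT; apply/rootP.
Qed.

Lemma rolle_uniq P t : uniq t -> all (root P) t ->
  exists t', [/\ size t' = (size t).-1, uniq t' & all (root P^`()) t'].
Proof.
move=> ut rt; have : sorted <%R (sort <=%R t) by rewrite sort_lt_sorted.
have : all (root P) (sort <=%R t) by rewrite all_sort.
rewrite -(size_sort <=%R t); case: (sort _ t) => [|x s] rs ss.
  by exists [::].
have [t' [st' xt' rt']] := rolle_path ss rs; exists t'; split=> //.
have := lt_sorted_uniq (path_sorted xt'); exact.
Qed.

Lemma expr_odd_inj (k : nat) : odd k -> injective (fun x : R => x ^+ k).
Proof.
move=> ok x y /= E; have k0 : (0 < k)%N by case: k ok {E}.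
have : `|x| = `|y|.
  apply: (pexpIrn k0); rewrite ?nnegrE // -!normrX; congr `|_|; exact: E.
move/eqP; rewrite eqr_norm2 => /orP[/eqP //|/eqP xy].
move: E; rewrite xy exprNn -signr_odd ok expr1 mulN1r => /eqP.
rewrite -subr_eq0 -opprD oppr_eq0 -mulr2n -mulr_natr mulf_eq0 pnatr_eq0 orbF.
by rewrite expf_eq0 k0 /= => /eqP ->; rewrite oppr0.
Qed.

Lemma Wpoly_Xn n p q : Wpoly 'X^n p q =
  (2%:R * p) *: 'X^3 - q *: 'X^2 + 2%:R *: 'X
  + (2%:R / (n + 2)%:R * p ^+ (n + 2)) *: 'X^(n + 2).
Proof.
have -> : Wpoly 'X^n p q = (2%:R * p) *: 'X^3 - q *: 'X^2 + 2%:R *: 'X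
    + (p *: 'X) ^+ 2 * (((2%:R / (n + 2)%:R) *: 'X^n) \Po (p *: 'X)).
  rewrite /Wpoly; congr (_ + _ * (_ \Po _)); apply/polyP => i.
  rewrite (coef_sub_polyh (@charR0 R)) coefZ coefXn.
  by case: eqP => [->|_]; rewrite ?mul1r ?mulr1 ?mul0r ?mulr0.
congr (_ + _); rewrite comp_polyZ comp_Xn_poly -scalerAr -exprD exprZn scalerA.
by rewrite addnC.
Qed.

Lemma Wpoly_Xn_roots n p q r t : ~~ odd n -> (3 < n)%N -> p != 0 -> uniq t ->
  all (root (Wpoly 'X^n p q - r%:P)) t -> (size t <= 4)%N.
Proof.
move=> en n3 p0 ut rt.
have [t1 [s1 u1 r1]] := rolle_uniq ut rt.
have [t2 [s2 u2 r2]] := rolle_uniq u1 r1.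
have [t3 [s3 u3 r3]] := rolle_uniq u2 r2.
have D3 : exists a b, a != 0 /\
    (Wpoly 'X^n p q - r%:P)^`()^`()^`() = a *: 'X^(n - 1) + b%:P.
  pose c := 2%:R / (n + 2)%:R * p ^+ (n + 2).
  (* Three derivations kill the terms of degree at most 2; the constant comes from 2 p X^3, with 3!
     = 6. *)
  exists (c * ((n + 2) ^_ 3)%:R), (2%:R * p * 6%:R); split.
    rewrite !mulf_neq0 ?invr_eq0 ?expf_neq0 ?pnatr_eq0 //.
      by rewrite addn2.
    by rewrite -lt0n ffact_gt0 addn2 (leqW (leqW (ltnW n3))).
  rewrite -[LHS]/(_^`(3)) Wpoly_Xn -/c -[X in 2%:R *: X]expr1.
  rewrite !(derivnD, derivnN, derivnZ, derivnXn, derivnC).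
  have -> : (3 ^_ 3 = 6)%N by [].
  have -> : (2 ^_ 3 = 0)%N by [].
  have -> : (1 ^_ 3 = 0)%N by [].
  have sc (e : R) (Q : {poly R}) k : e *: (Q *+ k) = (e * k%:R) *: Q.
    by rewrite -scaler_nat scalerA.
  rewrite !sc !mulr0 !scale0r oppr0 !addr0 expr0 alg_polyC.
  have -> : (n + 2 - 3 = n - 1)%N by rewrite addn2 subSS subSS.
  by rewrite addrC.
have [a [b [a0 D3E]]] := D3.
have on1 : odd (n - 1).
  by case: n en n3 {D3 D3E rt r1 r2 r3} => //= n; rewrite subn1 negbK.
case: t3 s3 u3 r3 => [|x [|y t3]] s3 u3 r3.
- by move: s3; rewrite s2 s1; case: (size t) => [|[|[|[|[|]]]]].
- by move: s3; rewrite s2 s1; case: (size t) => [|[|[|[|[|]]]]].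
move: u3 => /= /andP[]; rewrite inE negb_or => /andP[/eqP xy _] _; case: xy.
move: r3; rewrite D3E /= => /and3P[/rootP + /rootP + _].
rewrite !(hornerD, hornerZ, hornerXn, hornerC) => /eqP + /eqP.
rewrite !addr_eq0 => /eqP <- /eqP /(mulfI a0).
by move=> /esym/(expr_odd_inj on1).
Qed.

Lemma G_d_Gtuple d : (2 < d)%N -> G_d R d = Gtuple 'X^(d - 2).
Proof.
move=> d2; rewrite /G_d (@G_eta_Gtuple _ _ (d - 1)); last first.
  move=> j j0 dj; case: eqP => // jd; move: dj; rewrite jd.
  by rewrite leqNgt ltn_sub2l // (ltn_trans _ d2).
congr Gtuple; apply/polyP => i; rewrite coef_poly coefXn.
case: (i =P (d - 2)%N) => [->|_]; last by rewrite mul0rn if_same.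
by rewrite ltn_sub2l ?(ltn_trans _ d2) // -lt0n subn_gt0 d2 mulr1n.
Qed.

Lemma G_d_fibre_card d : ~~ odd d -> (6 <= d)%N ->
  forall w, real_fibre (G_d R d) w #<= `I_4.
Proof.
move=> ed d6; rewrite G_d_Gtuple ?(leq_trans _ d6) //.
apply: fibre_card_le => // p q r t; apply: Wpoly_Xn_roots.
  by rewrite oddB ?(leq_trans _ d6) // addbF.
by rewrite ltn_subRL (leq_trans _ d6).
Qed.

End RealRoots.

(** * A map with a real fibre of full cardinality d *)

Section FullFibre.
Variable R : realType.

(* All the coefficients are positive, so a multiple has linear coefficient 2. *)
Definition split_poly (d : nat) : {poly R} :=
  \prod_(z <- [seq - (i.+1%:R) | i <- iota 0 d]) ('X - z%:P).

Lemma size_split_poly d : size (split_poly d) = d.+1.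
Proof. by rewrite size_prod_XsubC size_map size_iota. Qed.

Lemma coef_split_poly_gt0 d i : (i <= d)%N -> 0 < (split_poly d)`_i.
Proof.
elim: d i => [|d IH] i id.
  by move: id; rewrite leqn0 => /eqP ->; rewrite /split_poly big_nil coef1.
have -> : split_poly d.+1 = split_poly d * ('X + (d.+1%:R)%:P).
  rewrite /split_poly -[d.+1 in LHS]addn1 iotaD map_cat big_cat /= big_seq1.
  by rewrite add0n polyCN opprK.
rewrite mulrDr coefD coefMX coefMC; case: i id => [|i] id /=.
  by rewrite add0r mulr_gt0 // IH.
rewrite ltr_wpDr //; last exact: IH.
rewrite mulr_ge0 //; have [/IH/ltW //|di] := leqP i.+1 d.
by rewrite nth_default // size_split_poly.
Qed.

Lemma split_poly_simple_roots d s :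
  s \in [seq - (i.+1%:R) | i <- iota 0 d] ->
  root (split_poly d) s /\ ~~ root (split_poly d)^`() s.
Proof.
move=> sd; have rs : root (split_poly d) s by rewrite root_prod_XsubC.
split=> //; apply: coprimep_root rs.
have : separable_poly (split_poly d); last by rewrite separable_poly.unlock.
rewrite separable_prod_XsubC map_inj_uniq ?iota_uniq //.
by move=> i j /oppr_inj /eqP; rewrite eqr_nat eqSS => /eqP.
Qed.

Lemma full_fibre d : (4 < d)%N -> exists (eta : nat -> R) (g : {poly R}),
  [/\ finitely_supported eta, G_eta eta = Gtuple g, size g = (d - 1)%N,
      0 < lead_coef g & exists w, `I_d #<= real_fibre (Gtuple g) w].
Proof.
move=> d4; have d2 : (d - 2).+2 = d by rewrite -addn2 subnK // (leq_trans _ d4).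
have d1 : (d - 1 = (d - 2).+1)%N by rewrite -[in LHS]d2 subn1.
have c0 : (split_poly d)`_1 != 0.
  by rewrite gt_eqF // coef_split_poly_gt0 // (leq_trans _ d4).
pose c := 2%:R / (split_poly d)`_1.
have cgt0 : 0 < c by rewrite divr_gt0 ?coef_split_poly_gt0 // (leq_trans _ d4).
pose T := c *: split_poly d.
(* Solves for eta the equation W - R = T at P = 1: the coefficient of s^(j + 2) is eta_j (2 / (j +
   2)), plus the 2 of the cubic term when j = 1. *)
pose eta j := (T`_(j + 2) - 2%:R *+ (j == 1)%N) * ((j + 2)%:R / 2%:R).
have eta0 j : (0 < j)%N -> (d - 1 <= j)%N -> eta j = 0.
  rewrite d1 => j0 dj; have j1 : (j == 1)%N = false.
    by apply/gtn_eqF/leq_trans/dj; rewrite ltnS -ltnS -ltnS d2 (leq_trans _ d4).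
  rewrite /eta j1 mulr0n subr0 nth_default ?mul0r //.
  by rewrite (leq_trans (size_scale_leq _ _)) // size_split_poly addn2 -d2 !ltnS.
pose g := \poly_(j < (d - 1)%N) (eta j *+ (j != 0)%N).
have n20 : 2%:R != 0 :> R by rewrite pnatr_eq0.
have kE j : (g - polyh g)`_j = (T`_(j + 2) - 2%:R *+ (j == 1)%N) *+ (j != 0)%N.
  rewrite (coef_sub_polyh (@charR0 R)) coef_poly.
  have j20 : (j + 2)%:R != 0 :> R by rewrite pnatr_eq0 addn2.
  have etaK : eta j * (2%:R / (j + 2)%:R) = T`_(j + 2) - 2%:R *+ (j == 1)%N.
    by rewrite /eta -mulrA -[2%:R / _]invf_div mulfV ?mulr1 // mulf_neq0 ?invr_eq0.
  case: ltnP => dj; first by rewrite [eta j *+ _ * _]mulrnAl etaK.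
  by have [->|j0] := posnP j; rewrite ?mulr0n ?mul0r // -etaK eta0 // !mul0r mul0rn.
have gd : g`_(d - 2) = T`_d * (d%:R / 2%:R).
  rewrite coef_poly d1 ltnSn /eta addn2 d2.
  have -> : (d - 2 == 1)%N = false.
    by apply/gtn_eqF; rewrite -ltnS -ltnS d2 (leq_trans _ d4).
  have -> : (d - 2 != 0)%N by rewrite -lt0n -ltnS -ltnS d2 (leq_trans _ d4).
  by rewrite mulr0n subr0 mulr1n.
have gd0 : 0 < g`_(d - 2).
  rewrite gd mulr_gt0 // ?divr_gt0 ?ltr0n // ?(leq_trans _ d4) //.
  by rewrite coefZ mulr_gt0 // coef_split_poly_gt0.
have sg : size g = (d - 1)%N.
  apply/eqP; rewrite eqn_leq size_poly /= d1 ltnNge; apply/negP => /leq_sizeP.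
  by move=> /(_ _ (leqnn _)) g0; rewrite g0 ltxx in gd0.
exists eta, g; split=> //.
- apply: (sub_finite_set _ (finite_II (d - 1))) => j [/= j0].
  by rewrite ltnNge => /negP nz; apply/negP => dj; apply: nz; rewrite eta0.
- exact: G_eta_Gtuple.
- by rewrite lead_coefE sg d1.
(* Q and R supply the coefficients of degrees 2 and 0; the linear one is 2 by the scaling of T. *)
- exists (row3 1 (- T`_2) (- T`_0)).
have WT : Wpoly g 1 (- T`_2) - (- T`_0)%:P = T.
  apply/polyP => i; rewrite coefB coefC coef_Wpoly expr1n mul1r kE.
  have T1 : T`_1 = 2%:R by rewrite coefZ divfK.
  case: i => [|[|[|[|i]]]] /=; rewrite ?addn2 ?mulr0n ?mulr1n ?T1; ring.
have -> : `I_d = `I_(size [seq - (i.+1%:R : R) | i <- iota 0 d]).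
  by rewrite size_map size_iota.
apply: fibre_card_ge => [|s sd].
  rewrite map_inj_uniq ?iota_uniq // => i j /oppr_inj /eqP.
  by rewrite eqr_nat eqSS => /eqP.
have [r1 r2] := split_poly_simple_roots sd; rewrite WT rootZ ?gt_eqF //.
have -> : (Wpoly g 1 (- T`_2))^`() = T^`() by rewrite -[in RHS]WT derivB derivC subr0.
by rewrite derivZ rootZ ?gt_eqF.
Qed.

End FullFibre.

(** * Non-density of the image when d is even and the top coefficient is positive *)

Section NonDense.
Variable R : realType.
Implicit Types (g k : {poly R}) (p q r s u e : R).

(** The top term L u^(n + 2) has even exponent and L > 0, while all the other terms and e are
    bounded by multiples of m^(n + 1), m = max(1, |u|). The bound M is uniform in e, which will
    carry the terms of W depending on P and Q. *)
Lemma even_poly_lower_bound k n (D : R) : size k = n.+1 -> ~~ odd n ->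
  0 < lead_coef k -> 0 <= D ->
  exists M, forall u e, `|e| <= D * Num.max 1 `|u| ^+ n.+1 ->
    - M < u ^+ 2 * k.[u] + e.
Proof.
move=> sk en; rewrite lead_coefE sk /=; set L := k`_n => L0 D0.
pose C := \sum_(i < n) `|k`_i|.
have C0 : 0 <= C by apply: sumr_ge0.
pose E := C + D; have E0 : 0 <= E by rewrite addr_ge0.
(* The sum is at least m^(n + 1) (L m - E) - L. The product is nonnegative if L m >= E; otherwise m
   < E / L bounds it below by - E (E / L)^(n + 1). The final 1 makes the inequality strict. *)
exists (L + E * (E / L) ^+ n.+1 + 1) => u e ebound.
set m := Num.max 1 `|u| in ebound.
have m1 : 1 <= m by rewrite le_max lexx.
have um : `|u| <= m by rewrite le_max lexx orbT.
have m0 : 0 <= m by exact: le_trans ler01 m1.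
have mn0 : 0 <= m ^+ n.+1 by rewrite exprn_ge0.
have low : `|\sum_(i < n) k`_i * u ^+ (i + 2)| <= C * m ^+ n.+1.
  apply: le_trans (ler_norm_sum _ _ _) _; rewrite mulr_suml.
  apply: ler_sum => i _; rewrite normrM normrX; apply: ler_wpM2l => //.
  apply: (le_trans (lerXn2r (i + 2) _ _ um)); rewrite ?nnegrE //.
  by apply: ler_weXn2l => //; rewrite addn2 ltnS.
have top : L * m ^+ n.+2 - L <= L * u ^+ n.+2.
  rewrite -[X in _ - X]mulr1 -mulrBr ler_pM2l //.
  have -> : u ^+ n.+2 = `|u| ^+ n.+2.
    by rewrite -normrX ger0_norm // exprn_even_ge0 //= negbK.
  have [u1|u1] := leP 1 `|u|.
    by rewrite /m max_r // lerBlDr lerDl.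
  by rewrite /m max_l ?(ltW u1) // expr1n subrr exprn_ge0.
have -> : u ^+ 2 * k.[u] = \sum_(i < n) k`_i * u ^+ (i + 2) + L * u ^+ n.+2.
  rewrite horner_coef sk big_ord_recr /= mulrDr mulr_sumr; congr (_ + _).
    by apply: eq_bigr => i _; rewrite mulrCA -exprD addnC.
  by rewrite -/L mulrCA -exprD.
have key : - (L + E * (E / L) ^+ n.+1) <= m ^+ n.+1 * (L * m - E) - L.
  rewrite opprD addrC lerD2r.
  have [Lm|Lm] := leP E (L * m).
    apply: le_trans (_ : 0 <= _); last by rewrite mulr_ge0 // subr_ge0.
    by rewrite oppr_le0 mulr_ge0 // exprn_ge0 // divr_ge0 // ltW.
  apply: le_trans (_ : - (m ^+ n.+1 * E) <= _); last first.
    by rewrite -mulrN ler_wpM2l // lerDr mulr_ge0 // ltW.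
  rewrite lerN2 mulrC ler_wpM2l // lerXn2r ?nnegrE // ?divr_ge0 // ?(ltW L0) //.
  by rewrite ler_pdivlMr // mulrC ltW.
move: low top key ebound; rewrite !ler_norml => /andP[low _] top key /andP[eb _].
have EE : m ^+ n.+1 * E = C * m ^+ n.+1 + D * m ^+ n.+1 by rewrite /E; ring.
rewrite mulrBr mulrCA -exprSr EE in key.
move: key low top eb; move: (E * _) => K.
move: (C * _) (D * _) (L * m ^+ _) (L * u ^+ _) => a b c c'.
move: (\sum_(i < n) _) => S; lra.
Qed.

(** The image misses the ball of radius 1/2 around (1, 0, - (M + 1)): there R < - M, whereas R is a
    value of W, which stays above - M for such P and Q. *)
Lemma Gtuple_nondense g : odd (size g) -> (2 < size g)%N -> 0 < lead_coef g ->
  nondense_image (Gtuple g : polymap R 3).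
Proof.
move=> og g2 lg0; case E : (size g) => [|n]; first by rewrite E in og.
rewrite E in og g2.
have kc i : (g - polyh g)`_i = g`_i * (2%:R / (i + 2)%:R).
  exact: (coef_sub_polyh (@charR0 R)).
have kn : 0 < (g - polyh g)`_n.
  rewrite kc mulr_gt0 ?divr_gt0 ?ltr0n ?addn2 //.
  by move: lg0; rewrite lead_coefE E.
have sk : size (g - polyh g) = n.+1.
  apply/eqP; rewrite eqn_leq; apply/andP; split.
    by apply/leq_sizeP => j nj; rewrite kc nth_default ?mul0r ?E.
  rewrite ltnNge; apply/negP => /leq_sizeP /(_ n (leqnn _)) k0.
  by rewrite k0 ltxx in kn.
have lk : 0 < lead_coef (g - polyh g) by rewrite lead_coefE sk.
(* In the ball |p| <= 2, |q| <= 1 and |s| <= 2 m, so the terms of degree 3, 2, 1 in s contribute at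
   most 32 + 4 + 4 times m^3, below 64 m^3. *)
have [M Mlow] := @even_poly_lower_bound _ n 64%:R sk og lk (ler0n _ _).
pose w0 : 'rV[R]_3 := row3 1 0 (- (M + 1)).
move=> dns; have h0 : 0 < 2%:R^-1 :> R by rewrite invr_gt0 ltr0n.
have O0 : interior (ball w0 2%:R^-1) !=set0.
  by exists w0; apply: nbhsx_ballx.
have [w [/interior_subset + [v _ vw]]] := dns _ O0 (open_interior _).
rewrite -vw [v]row3E polymap_eval_Gtuple {vw w}.
move: (v _ _) (v _ _) (v _ _) => z y x [_ B].
have := (B 0 (inord 0), B 0 (inord 1), B 0 (inord 2)).
rewrite !mxE !vec3E -!ball_normE /= => -[[]].
set p := ptP x y z; set q := ptQ g x y z; set r := ptR (polyh g) x y z.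
rewrite !ltr_norml => /andP[p1 p2] /andP[q1 q2] /andP[r1 r2].
have A0 : ptA x y != 0.
  apply/eqP => A0; move: p2; rewrite /p /ptP A0 mul0r; lra.
set s := x / ptA x y.
have Wr : invW g (polyh g) p q s = r by exact: invW_ratio.
clearbody p q r s.
have := Mlow (s * p) (2%:R * p * s ^+ 3 - q * s ^+ 2 + 2%:R * s).
set m := Num.max 1 _.
have m1 : 1 <= m by rewrite le_max lexx.
have um : `|s * p| <= m by rewrite le_max lexx orbT.
have sm : `|s| <= 2%:R * m.
  have pp : 2%:R^-1 <= `|p| by rewrite ger0_norm; lra.
  move: um; rewrite normrM => um; have := normr_ge0 s; nra.
have m3 : m ^+ 3 <= m ^+ n.+1 by apply: ler_weXn2l.
have bound : `|2%:R * p * s ^+ 3 - q * s ^+ 2 + 2%:R * s| <= 64%:R * m ^+ n.+1.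
  apply: (@le_trans _ _ (64%:R * m ^+ 3)); last by rewrite ler_pM2l ?ltr0n.
  apply: le_trans (ler_normD _ _) _.
  apply: le_trans (lerD (ler_normB _ _) (lexx _)) _.
  rewrite !(normrX, normrM).
  have pp : `|p| <= 2%:R by rewrite ger0_norm; lra.
  have qq : `|q| <= 1 by rewrite ler_norml; apply/andP; split; lra.
  have n2 : `|2%:R| = 2%:R :> R by rewrite ger0_norm ?ler0n.
  rewrite n2; move: (normr_ge0 s) (normr_ge0 p) (normr_ge0 q) sm pp qq.
  move: `|s| `|p| `|q| => S P Q S0 P0 Q0 sm pp qq.
  have m0 : 0 <= m by lra.
  have S2 : S ^+ 2 <= 4%:R * m ^+ 2.
    by rewrite (_ : 4%:R * m ^+ 2 = (2%:R * m) ^+ 2) ?lerXn2r ?nnegrE //;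
      [lra | ring].
  have S3 : S ^+ 3 <= 8%:R * m ^+ 3.
    by rewrite (_ : 8%:R * m ^+ 3 = (2%:R * m) ^+ 3) ?lerXn2r ?nnegrE //;
      [lra | ring].
  have t1 : P * S ^+ 3 <= 2%:R * (8%:R * m ^+ 3).
    by apply: ler_pM => //; exact: exprn_ge0.
  have t2 : Q * S ^+ 2 <= 1 * (4%:R * m ^+ 2).
    by apply: ler_pM => //; exact: exprn_ge0.
  have m23 : m ^+ 2 <= m ^+ 3 by apply: ler_weXn2l.
  have m13 : m <= m ^+ 3 by rewrite -{1}[m]expr1; apply: ler_weXn2l.
  rewrite -mulrA; lra.
have Er : (s * p) ^+ 2 * (g - polyh g).[s * p]
    + (2%:R * p * s ^+ 3 - q * s ^+ 2 + 2%:R * s) = r.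
  by rewrite -Wr /invW hornerD hornerN addrC.
move=> /(_ bound); rewrite Er => Mr.
move: r1 r2 Mr; clear; move: r => r0; lra.
Qed.

End NonDense.

(** * Maximal fibre cardinalities and the final statements *)

Section Conclusion.
Variable R : realType.

(** Take the least uniform bound: if it is positive, some fibre violates the preceding bound and so
    has exactly that cardinality; if it is 0, every fibre is empty. *)
Lemma max_fibre_card_exists (n : nat) (H : polymap R n) (N : nat) :
  (forall w, real_fibre H w #<= `I_N) ->
  exists2 m, (m <= N)%N & max_fibre_card H m.
Proof.
move=> HN; pose bounds m := `[< forall w, real_fibre H w #<= `I_m >].
have exb : exists m, bounds m by exists N; apply/asboolP.
case: (ex_minnP exb) => m /asboolP mb mmin; exists m.
  by apply: mmin; apply/asboolP.
split=> //; case: m mb mmin => [|m] mb mmin.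
  by exists 0; rewrite card_eq_le mb II0 card_ge0.
have [w wm] : exists w, ~ (real_fibre H w #<= `I_m).
  by apply/existsNP => mb'; have := mmin m (asboolT mb'); rewrite ltnn.
have [k wk] : finite_set (real_fibre H w) by exact: card_le_finite (mb w) _.
have km : (k <= m.+1)%N by rewrite -card_le_II -(card_le_eql wk).
have mk : (m < k)%N.
  by rewrite ltnNge; apply/negP => km'; apply: wm; rewrite (card_le_eql wk) card_le_II.
by exists w; rewrite (_ : m.+1 = k) //; apply/eqP; rewrite eqn_leq km mk.
Qed.

Lemma G_d_generic_degree d : (3 < d)%N -> generic_degree (G_d R d) d.
Proof.
move=> d3; rewrite G_d_Gtuple ?(ltnW d3) //.
have := @generic_degree_Gtuple R 'X^(d - 2); rewrite size_polyXn.
have -> : (d - 2).+2 = d by rewrite -addn2 subnK // (leq_trans _ d3).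
by apply; rewrite ltnS ltn_subRL.
Qed.

Lemma G_d_nondense d : ~~ odd d -> (3 < d)%N -> nondense_image (G_d R d).
Proof.
move=> ed d3; rewrite G_d_Gtuple ?(ltnW d3) //; apply: Gtuple_nondense.
- by rewrite size_polyXn /= oddB ?addbF // (leq_trans _ d3).
- by rewrite size_polyXn ltnS ltn_subRL.
- by rewrite lead_coefXn.
Qed.

Lemma full_fibre_keller d : ~~ odd d -> (6 <= d)%N -> exists eta : nat -> R,
  [/\ finitely_supported eta, keller (G_eta eta), nondense_image (G_eta eta),
      generic_degree (G_eta eta) d &
      (exists w, real_fibre (G_eta eta) w #= `I_d) /\
      (forall w, real_fibre (G_eta eta) w #<= `I_d)].
Proof.
move=> ed d6; have [eta [g [feta eG sg lg [w wd]]]] := full_fibre R (ltnW d6).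
have g2 : (2 < size g)%N by rewrite sg ltn_subRL (leq_trans _ d6).
have sgd : (size g).+1 = d by rewrite sg subn1 prednK // (leq_trans _ d6).
have le_d w' : real_fibre (Gtuple g) w' #<= `I_d.
  by rewrite -sgd; exact: fibre_card_le_degree.
exists eta; rewrite eG; split=> //.
- exact: keller_Gtuple.
- by apply: Gtuple_nondense; rewrite // -[odd _]negbK -/(odd _.+1) sgd.
- by rewrite -sgd; exact: generic_degree_Gtuple.
- by split=> //; exists w; rewrite card_eq_le le_d wd.
Qed.

End Conclusion.

Theorem mainTheorem4 (R : realType) :
  (exists (H1 H2 : polymap R 3) (d m1 m2 : nat),
     [/\ keller H1, nondense_image H1, generic_degree H1 d
       & max_fibre_card H1 m1] /\
     [/\ keller H2, nondense_image H2, generic_degree H2 d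
       & max_fibre_card H2 m2] /\
     m1 <> m2) /\
  (forall d : nat, ~~ odd d -> (6 <= d)%N ->
     [/\ keller (G_d R d), nondense_image (G_d R d),
         generic_degree (G_d R d) d
       & forall w : 'rV[R]_3, real_fibre (G_d R d) w #<= `I_4] /\
     (exists eta : nat -> R,
        [/\ finitely_supported eta, keller (G_eta eta),
            nondense_image (G_eta eta), generic_degree (G_eta eta) d
          & exists w : 'rV[R]_3, real_fibre (G_eta eta) w #= `I_d])) /\
  (~ exists N : nat, forall H : polymap R 3,
       keller H -> nondense_image H ->
       forall w : 'rV[R]_3, real_fibre H w #<= `I_N).
Proof.
have Gd d : ~~ odd d -> (6 <= d)%N ->
    [/\ keller (G_d R d), nondense_image (G_d R d), generic_degree (G_d R d) d
       & forall w : 'rV[R]_3, real_fibre (G_d R d) w #<= `I_4].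
  move=> ed d6; have d3 : (3 < d)%N by rewrite (leq_trans _ d6).
  split; [|exact: G_d_nondense|exact: G_d_generic_degree|exact: G_d_fibre_card].
  by rewrite G_d_Gtuple ?(ltnW d3) //; exact: keller_Gtuple.
split; last split.
(* Already d = 6 separates the two maps: the maximum is at most 4 for [G_d R 6] and equals 6 for the
   other. *)
- have [kG nG dG bG] := Gd 6%N isT isT.
  have [m1 m14 maxG] := max_fibre_card_exists bG.
  have [eta [_ kH nH dH maxH]] := full_fibre_keller R (d := 6) isT isT.
  exists (G_d R 6), (G_eta eta), 6%N, m1, 6%N; do !split=> //.
  by move=> m16; rewrite m16 in m14.
- move=> d ed d6; split; first exact: Gd.
  have [eta [feta kH nH dH [eqH _]]] := full_fibre_keller R ed d6.
  by exists eta.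
- move=> [N bN].
  (* The degree 2 (N + 3) is even, at least 6 and larger than N, so a full fibre exceeds the
     supposed bound. *)
  have ed : ~~ odd N.+3.*2 by rewrite odd_double.
  have d6 : (6 <= N.+3.*2)%N by rewrite !doubleS.
  have [eta [_ kH nH _ [[w wd] _]]] := full_fibre_keller R ed d6.
  have := bN _ kH nH w; rewrite (card_le_eql wd) card_le_II.
  by rewrite leqNgt -addnn ltn_addr // ltnW // ltnW.
Qed.
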